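(* Let $(X,\mathscr A,\mu)$ be a $\sigma$-finite measure space, $w\colon X\to\mathbb C$ an $\mathscr A$-measurable function and $\phi\colon X\to X$ an $\mathscr A$-measurable transformation such that $\mu_w\circ\phi^{-1}\ll\mu$. Let $\alpha\in(0,1]$. Suppose that $C_{\phi,w}$ is densely defined. Consider the following four conditions: (i) $\mathsf h_{\phi,w}\geqslant c$ a.e. $[\mu]$ for some $c\in(0,\infty)$; (ii) $\mathsf E_{\phi,w}(\mathsf h_{\phi,w}^\alpha)\circ\phi^{-1}\geqslant c$ a.e. $[\mu]$ on $\{\mathsf h_{\phi,w}\neq0\}$ for some $c\in(0,\infty)$; (iii) $c\,(\mathsf E_{\phi,w}(\mathsf h_{\phi,w}^\alpha)\circ\phi^{-1})\,\mathsf h_{\phi,w}^{1-\alpha}\geqslant\mathsf h_{\phi,w}^{1-\alpha}$ a.e. $[\mu]$ on $\{\mathsf h_{\phi,w}\neq0\}$ for some $c\in(0,\infty)$; (iv) $c\Big(1+(\mathsf E_{\phi,w}(\mathsf h_{\phi,w}^\alpha)\circ\phi^{-1})\,\mathsf h_{\phi,w}^{1-\alpha}\Big)\geqslant\mathsf h_{\phi,w}^{1-\alpha}$ a.e. $[\mu]$ on $\{\mathsf h_{\phi,w}\neq0\}$ for some $c\in(0,\infty)$. Then (i) implies (ii), (ii) and (iii) are equivalent, and (iii) implies (iv). If $\mathsf h_{\phi,w}\in L^\infty(\mu)$, then (iv) holds. Moreover, if any of the conditions (i) to (iv) is satisfied, then $\Delta_\alpha(C_{\phi,w})=C_{\ph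i,w_\alpha}$.
   Context: $\overline{\mathbb R}_+=[0,\infty]$. A transformation $\phi\colon X\to X$ is $\mathscr A$-measurable if $\phi^{-1}(\Delta)\in\mathscr A$ for all $\Delta\in\mathscr A$. $\mu_w(\Delta)=\int_\Delta|w|^2\,\mathrm d\mu$ and $\mu_w\circ\phi^{-1}(\Delta)=\mu_w(\phi^{-1}(\Delta))$ for $\Delta\in\mathscr A$. If $\mu_w\circ\phi^{-1}\ll\mu$, then $\mathsf h_{\phi,w}\colon X\to\overline{\mathbb R}_+$ is the ($\mu$-a.e. unique) Radon–Nikodym derivative: $\mu_w\circ\phi^{-1}(\Delta)=\int_\Delta\mathsf h_{\phi,w}\,\mathrm d\mu$, $\Delta\in\mathscr A$, and the weighted composition operator $C_{\phi,w}$ in $L^2(\mu)$ is defined by $\mathcal D(C_{\phi,w})=\{f\in L^2(\mu)\colon w\cdot(f\circ\phi)\in L^2(\mu)\}$, $C_{\phi,w}f=w\cdot(f\circ\phi)$; it is a closed operator and it is densely defined iff $\mathsf h_{\phi,w}<\infty$ a.e. $[\mu]$. Assuming $\mathsf h_{\phi,w}<\infty$ a.e. $[\mu]$, $\mu_w|_{\phi^{-1}(\mathscr A)}$ is $\sigma$-finite, and $\mathsf E_{\phi,w}(f)$ denotes the conditional expectation of $f$ with respect to the $\sigma$-algebra $\phi^{-1}(\mathscr A)=\{\phi^{-1}(\Delta)\colon\Delta\in\mathscr A\}$ and the measure $\mu_w$, for $\mathscr A$-measurable $f\colon X\to\overline{\mathbb R}_+$ or $f\in L^p(\mu_w)$,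 $p\in[1,\infty]$. For such $f$, $\mathsf E_{\phi,w}(f)\circ\phi^{-1}$ denotes the ($\mu$-a.e. unique) $\mathscr A$-measurable function $g$ on $X$ such that $\mathsf E_{\phi,w}(f)=g\circ\phi$ a.e. $[\mu_w]$ and $g=g\cdot\chi_{\{\mathsf h_{\phi,w}>0\}}$ a.e. $[\mu]$. For $\alpha\in(0,1]$ and densely defined $C_{\phi,w}$, $w_\alpha\colon X\to\mathbb C$ is an $\mathscr A$-measurable function with $w_\alpha=w\cdot\big(\frac{\mathsf h_{\phi,w}}{\mathsf h_{\phi,w}\circ\phi}\big)^{\alpha/2}$ a.e. $[\mu]$ (one has $\mathsf h_{\phi,w}\circ\phi>0$ a.e. $[\mu_w]$; $w_\alpha=0$ a.e. on $\{w=0\}$). Moreover $\mu_{w_\alpha}\circ\phi^{-1}\ll\mu$, so $C_{\phi,w_\alpha}$ is defined. For a closed densely defined operator $A$ with polar decomposition $A=U|A|$ and $\alpha\in(0,1]$, the $\alpha$-Aluthge transform of $A$ is $\Delta_\alpha(A)=|A|^\alpha U|A|^{1-\alpha}$ (with its natural domain as a product of operators; $|A|^0$ is the identity). Equality of operators includes equality of domains. *)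

(* Defs.v *)
From HB Require Import structures.
From mathcomp Require Import all_boot all_order all_algebra sesquilinear.
From mathcomp Require Import all_classical all_reals all_analysis.
From mathcomp Require Import measurable_realfun ess_sup_inf.
From mathcomp Require Import complex generic_quotient ring_quotient.
Set Implicit Arguments.
Unset Strict Implicit.
Unset Printing Implicit Defensive.
Import Order.TTheory GRing.Theory Num.Theory.
Import numFieldNormedType.Exports.
Local Open Scope classical_set_scope.
Local Open Scope complex_scope.
Local Open Scope ring_scope.

Section operators.
Context (R : realType) (H : lmodType R[i]) (dot : {dot H for Num.conj}).
Local Notation "'[ x , y ]" := (dot x y).
Implicit Types (A B P : set (H * H)) (U : {linear H -> H}).

(* A (possibly unbounded) operator in H is represented by its graph, so that
   equality of operators includes equality of domains. *)
Definition op_dom A : set H := [set x | exists y, A (x, y)].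

Definition op_of_fun U : set (H * H) := [set p | p.2 = U p.1].

Definition op_comp B A : set (H * H) :=
  [set p | exists2 y, A (p.1, y) & B (y, p.2)].

Definition densely_defined A :=
  forall x (e : R), 0 < e ->
    exists2 y, op_dom A y & '[x - y, x - y] < (e ^+ 2)%:C.

(* Functional as soon as A is densely defined. *)
Definition op_adjoint A : set (H * H) :=
  [set p | forall q, A q -> '[q.2, p.1] = '[q.1, p.2]].

Definition positive_selfadjoint P :=
  [/\ densely_defined P, op_adjoint P = P & forall p, P p -> 0 <= '[p.2, p.1]].

Definition partial_isometry U :=
  (exists M : R, forall x, '[U x, U x] <= M%:C * '[x, x]) /\
  (forall x, (forall y, U y = 0 -> '[x, y] = 0) -> '[U x, U x] = '[x, x]).

Definition polar_decomposition A U P :=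
  [/\ positive_selfadjoint P,
      op_comp P P = op_comp (op_adjoint A) A,
      partial_isometry U,
      forall x, U x = 0 <-> A (x, 0)
    & A = op_comp (op_of_fun U) P].

Definition orthogonal_projection U :=
  (forall x, U (U x) = U x) /\ (forall x y, '[U x, y] = '[x, U y]).

Implicit Types (E : set R -> {linear H -> H}) (u : R -> R).

Definition scalar_measure E x : set R -> \bar R :=
  fun S => (complex.Re '[E S x, x])%:E.

Definition spectral_measure E :=
  [/\ forall S, measurable S -> orthogonal_projection (E S),
      forall x, E setT x = x
    & forall x, semi_sigma_additive (scalar_measure E x)].

Definition spectral_dom E u : set H :=
  [set x | (\int[scalar_measure E x]_t (u t ^+ 2)%:E < +oo)%E].

(* The integral of u with respect to the complex measure S |-> '[E S x, y],
   by polarization; meaningful for x and y in [spectral_dom E u]. *)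
Definition spectral_form E u x y : R[i] :=
  4^-1 * \sum_(k < 4) 'i ^+ k *
    (fine (\int[scalar_measure E (x + 'i ^+ k *: y)]_t (u t)%:E))%:C.

(* The operator \int u dE; its domain is dense, so that p.2 is determined by
   p.1. *)
Definition spectral_integral E u : set (H * H) :=
  [set p | spectral_dom E u p.1 /\
    forall y, spectral_dom E u y -> '[p.2, y] = spectral_form E u p.1 y].

(* Q = P ^ s for a positive selfadjoint P. By the spectral theorem E exists, is
   unique and vanishes on `]-oo, 0[. Since 0 `^ 0 = 1, P ^ 0 is the identity. *)
Definition is_op_power P (s : R) Q :=
  exists E, [/\ spectral_measure E, P = spectral_integral E id
    & Q = spectral_integral E (fun t => t `^ s)].

(* B = |A|^a U |A|^(1 - a). The data U, |A| and the powers of |A| are all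
   uniquely determined by A. *)
Definition is_aluthge_transform (a : R) A B :=
  exists U P Pa P1a,
    [/\ polar_decomposition A U P, is_op_power P a Pa,
       is_op_power P (1 - a) P1a
     & B = op_comp Pa (op_comp (op_of_fun U) P1a)].

End operators.

Section complex_valued_functions.
Context (d : measure_display) (X : measurableType d) (R : realType).
Implicit Types (f g : X -> R[i]) (z : R[i]).

Definition cmeasurable f :=
  measurable_fun setT (fun x => complex.Re (f x)) /\
  measurable_fun setT (fun x => complex.Im (f x)).

Definition sqmod z : R := complex.Re z ^+ 2 + complex.Im z ^+ 2.

Variable mu : {measure set X -> \bar R}.

Definition cintegrable f :=
  mu.-integrable setT (EFin \o (fun x => complex.Re (f x))) /\
  mu.-integrable setT (EFin \o (fun x => complex.Im (f x))).

Definition cintegral f : R[i] :=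
  (\int[mu]_x complex.Re (f x)) +i* (\int[mu]_x complex.Im (f x)).

Lemma ReD z t : complex.Re (z + t) = complex.Re z + complex.Re t.
Proof. by case: z; case: t. Qed.
Lemma ImD z t : complex.Im (z + t) = complex.Im z + complex.Im t.
Proof. by case: z; case: t. Qed.
Lemma ReM z t : complex.Re (z * t) =
  complex.Re z * complex.Re t - complex.Im z * complex.Im t.
Proof. by case: z; case: t. Qed.
Lemma ImM z t : complex.Im (z * t) =
  complex.Re z * complex.Im t + complex.Im z * complex.Re t.
Proof. by case: z; case: t. Qed.
Lemma ReJ z : complex.Re (z^*)%C = complex.Re z.
Proof. by case: z. Qed.
Lemma ImJ z : complex.Im (z^*)%C = - complex.Im z.
Proof. by case: z. Qed.
Lemma complex_ext z t : complex.Re z = complex.Re t ->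
  complex.Im z = complex.Im t -> z = t.
Proof. by case: z t => [a b] [a' b'] /= -> ->. Qed.

Lemma cintegrableD f g : cintegrable f -> cintegrable g ->
  cintegrable (fun x => f x + g x).
Proof.
move=> [f1 f2] [g1 g2]; split.
  by apply: eq_integrable (integrableD _ f1 g1) => // x _ /=; rewrite ReD.
by apply: eq_integrable (integrableD _ f2 g2) => // x _ /=; rewrite ImD.
Qed.

Lemma cintegralD f g : cintegrable f -> cintegrable g ->
  cintegral (fun x => f x + g x) = cintegral f + cintegral g.
Proof.
move=> [f1 f2] [g1 g2]; apply: complex_ext; rewrite ?ReD ?ImD /=.
  by rewrite -RintegralD//; apply: eq_Rintegral => x _; rewrite ReD.
by rewrite -RintegralD//; apply: eq_Rintegral => x _; rewrite ImD.
Qed.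

Lemma cintegralZ z f : cintegrable f ->
  cintegral (fun x => z * f x) = z * cintegral f.
Proof.
move=> [f1 f2].
have iZ a (h : X -> R) : mu.-integrable setT (EFin \o h) ->
    mu.-integrable setT (EFin \o (fun x => a * h x)).
  by move=> ih; apply: eq_integrable (integrableZl _ a ih).
apply: complex_ext; rewrite ?ReM ?ImM /= -!RintegralZl//.
  rewrite -RintegralB//; [|exact: iZ..].
  by apply: eq_Rintegral => x _; rewrite ReM.
rewrite -RintegralD//; [|exact: iZ..].
by apply: eq_Rintegral => x _; rewrite ImM.
Qed.

Lemma cintegral_conj f : cintegrable f ->
  cintegral (fun x => (f x)^*)%C = (cintegral f)^*%C.
Proof.
move=> [f1 f2]; apply: complex_ext; rewrite ?ReJ ?ImJ /=.
  by apply: eq_Rintegral => x _; rewrite ReJ.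
rewrite -mulN1r -RintegralZl//.
by apply: eq_Rintegral => x _; rewrite ImJ mulN1r.
Qed.

Lemma ae_eq_Rintegral (f g : X -> R) : measurable_fun setT f ->
  measurable_fun setT g -> (\forall x \ae mu, f x = g x) ->
  \int[mu]_x f x = \int[mu]_x g x.
Proof.
move=> mf mg fg; congr fine; apply: ae_eq_integral => //.
- exact/measurable_EFinP.
- exact/measurable_EFinP.
- by apply: filterS fg => x -> _.
Qed.

Lemma ae_eq_cintegral f g : cmeasurable f -> cmeasurable g ->
  (\forall x \ae mu, f x = g x) -> cintegral f = cintegral g.
Proof.
move=> [f1 f2] [g1 g2] fg; apply: complex_ext => /=; apply: ae_eq_Rintegral => //.
  by apply: filterS fg => x ->.
by apply: filterS fg => x ->.
Qed.

Definition square_integrable f :=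
  cmeasurable f /\ (\int[mu]_x (sqmod (f x))%:E < +oo)%E.

Lemma Lfun2P (h : X -> R) : h \in Lfun mu 2%:E <->
  measurable_fun setT h /\ (\int[mu]_x (h x ^+ 2)%:E < +oo)%E.
Proof.
split=> [hL|[mh ih]].
  split; first by case/andP: hL; rewrite inE.
  have /integrableP[_] := Lfun2_integrable_sqr hL.
  by under eq_integral do rewrite /= ger0_norm ?sqr_ge0//.
apply/andP; split; first by rewrite inE.
rewrite inE/= /finite_norm unlock; apply: poweR_lty.
by under eq_integral do rewrite /= powR_mulrn// real_normK ?num_real//.
Qed.

Lemma square_integrableP f : square_integrable f <->
  (fun x => complex.Re (f x)) \in Lfun mu 2%:E /\
  (fun x => complex.Im (f x)) \in Lfun mu 2%:E.
Proof.
split=> [[[m1 m2] i]|[/Lfun2P[m1 i1] /Lfun2P[m2 i2]]].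
  have mS : measurable_fun setT (fun x => (sqmod (f x))%:E).
    apply/measurable_EFinP; apply: measurable_funD; exact: measurable_funX.
  split; apply/Lfun2P; split=> //; apply: le_lt_trans i; apply: ge0_le_integral => //.
  - by move=> x _; rewrite lee_fin sqr_ge0.
  - by apply/measurable_EFinP; exact: measurable_funX.
  - by move=> x _; rewrite lee_fin lerDl sqr_ge0.
  - by move=> x _; rewrite lee_fin sqr_ge0.
  - by apply/measurable_EFinP; exact: measurable_funX.
  - by move=> x _; rewrite lee_fin lerDr sqr_ge0.
split=> //; under eq_integral do rewrite /sqmod EFinD.
rewrite ge0_integralD//; first by rewrite lte_add_pinfty.
- by move=> x _; rewrite lee_fin sqr_ge0.
- by apply/measurable_EFinP; exact: measurable_funX.
- by move=> x _; rewrite lee_fin sqr_ge0.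
- by apply/measurable_EFinP; exact: measurable_funX.
Qed.

Lemma square_integrable_cintegrable f g :
  square_integrable f -> square_integrable g ->
  cintegrable (fun x => f x * (g x)^*%C).
Proof.
move=> /square_integrableP[f1 f2] /square_integrableP[g1 g2].
have i1 := (Lfun1_integrable _ _).1 (Lfun2_mul_Lfun1 f1 g1).
have i2 := (Lfun1_integrable _ _).1 (Lfun2_mul_Lfun1 f2 g2).
have i3 := (Lfun1_integrable _ _).1 (Lfun2_mul_Lfun1 f2 g1).
have i4 := (Lfun1_integrable _ _).1 (Lfun2_mul_Lfun1 f1 g2).
split.
  apply: eq_integrable (integrableD _ i1 i2) => // x _ /=.
  by rewrite ReM ReJ ImJ mulrN opprK.
apply: eq_integrable (integrableB _ i3 i4) => // x _ /=.
by rewrite ImM ReJ ImJ mulrN addrC.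
Qed.

Definition square_integrable_pred : {pred X -> R[i]} :=
  mem [set f | square_integrable f].

Lemma square_integrable_submod : submod_closed square_integrable_pred.
Proof.
split=> [|a f g]; rewrite !inE /=.
  apply/square_integrableP.
  split; apply/Lfun2P; split; try exact: measurable_cst;
    by under eq_integral do rewrite expr0n/=; rewrite integral0.
move=> /square_integrableP[f1 f2] /square_integrableP[g1 g2].
apply/square_integrableP.
have Z b h : h \in Lfun mu 2%:E -> (fun x => b * h x) \in Lfun mu 2%:E.
  move=> /(Lfun_scale b) H; rewrite (_ : (fun x => _) = b \o* h) ?H ?ler1n//.
  by apply/funext => x /=; rewrite mulrC.
have D (h k : X -> R) : h \in Lfun mu 2%:E -> k \in Lfun mu 2%:E ->
    (fun x => h x + k x) \in Lfun mu 2%:E.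
  have p1 : (1 <= 2%:E :> \bar R)%E by rewrite lee_fin ler1n.
  by move=> ? ?; apply: (Lfun_addr_closed mu p1).2.
split.
  rewrite (_ : (fun x => _) = (fun x => (complex.Re a * complex.Re (f x) +
    (- complex.Im a) * complex.Im (f x)) + complex.Re (g x))).
    by apply: (D) => //; apply: (D); apply: Z.
  by apply/funext => x; rewrite ReD ReM mulNr.
rewrite (_ : (fun x => _) = (fun x => (complex.Re a * complex.Im (f x) +
  complex.Im a * complex.Re (f x)) + complex.Im (g x))).
  by apply: (D) => //; apply: (D); apply: Z.
by apply/funext => x; rewrite ImD ImM.
Qed.

HB.instance Definition _ := GRing.isSubmodClosed.Build _ _
  square_integrable_pred square_integrable_submod.

Record l2fun := L2fun {
  l2fun_val :> X -> R[i]; l2fun_valP : l2fun_val \in square_integrable_pred }.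

HB.instance Definition _ := [isSub for l2fun_val].
HB.instance Definition _ := [Choice of l2fun by <:].
HB.instance Definition _ := [SubChoice_isSubLmodule of l2fun by <:].

Definition null_l2fun : {pred l2fun} :=
  mem [set f : l2fun | \forall x \ae mu, f x = 0].

Lemma null_l2fun_submod : submod_closed null_l2fun.
Proof.
split=> [|a f g]; rewrite !inE /=; first exact: aeW.
by apply: filterS2 => x /= f0 g0; rewrite -[LHS]/(a * f x + g x) f0 g0 mulr0 addr0.
Qed.

HB.instance Definition _ := GRing.isSubmodClosed.Build _ _
  null_l2fun null_l2fun_submod.

Local Open Scope quotient_scope.

Definition L2 : Type := Quotient.quot null_l2fun.
HB.instance Definition _ := Choice.on L2.
HB.instance Definition _ := EqQuotient.on L2.
HB.instance Definition _ := GRing.Zmodule.on L2.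

Definition l2repr (u : L2) : l2fun := repr u.
Coercion l2repr : L2 >-> l2fun.

Lemma L2_eqP (f g : l2fun) :
  \pi_L2 f = \pi_L2 g <-> (\forall x \ae mu, f x = g x).
Proof.
have E : (f - g \in null_l2fun) = (\pi_L2 f == \pi_L2 g :> L2).
  exact: Quotient.idealrBE.
split=> [/eqP|fg].
  rewrite -E inE; apply: filterS => x.
  by rewrite -[LHS]/(f x - g x) => /eqP; rewrite subr_eq0 => /eqP.
apply/eqP; rewrite -E inE; apply: filterS fg => x e.
by rewrite -[LHS]/(f x - g x) e subrr.
Qed.

Lemma l2reprK (f : l2fun) : \forall x \ae mu, (\pi_L2 f : L2) x = f x.
Proof. by apply/L2_eqP; rewrite /l2repr reprK. Qed.

Lemma L2_piD (f g : l2fun) : \pi_L2 (f + g) = \pi_L2 f + \pi_L2 g :> L2.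
Proof. exact: (@Quotient.pi_add _ (null_l2fun : zmodClosed _)). Qed.

Lemma L2_pi0 : \pi_L2 (0 : l2fun) = 0 :> L2.
Proof. by rewrite -[LHS](addrK (\pi_L2 (0 : l2fun))) -L2_piD addr0 subrr. Qed.

Lemma l2reprD (u v : L2) : \forall x \ae mu, (u + v : L2) x = u x + v x.
Proof.
rewrite -[u in (u + v)]reprK -[v in (_ + v)]reprK -L2_piD.
exact: l2reprK.
Qed.

Definition L2_scale (a : R[i]) (u : L2) : L2 := \pi_L2 (a *: (u : l2fun)).

Lemma L2_piZ a (f : l2fun) : L2_scale a (\pi_L2 f) = \pi_L2 (a *: f).
Proof.
apply/L2_eqP; apply: filterS (l2reprK f) => x e.
exact: (congr1 ( *%R a) e).
Qed.

Fact L2_scaleA a b u : L2_scale a (L2_scale b u) = L2_scale (a * b) u.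
Proof. by elim/quotW: u => f; rewrite (L2_piZ b) !L2_piZ scalerA. Qed.
Fact L2_scale1 : left_id 1 L2_scale.
Proof. by elim/quotW => f; rewrite L2_piZ scale1r. Qed.
Fact L2_scaleDr : right_distributive L2_scale +%R.
Proof.
move=> a; elim/quotW => f; elim/quotW => g.
by rewrite -L2_piD !L2_piZ -L2_piD scalerDr.
Qed.
Fact L2_scaleDl u : {morph L2_scale^~ u : a b / a + b}.
Proof. by elim/quotW: u => f a b; rewrite !L2_piZ -L2_piD scalerDl. Qed.

HB.instance Definition _ := GRing.Zmodule_isLmodule.Build R[i] L2
  L2_scaleA L2_scale1 L2_scaleDr L2_scaleDl.

Lemma l2reprZ a (u : L2) : \forall x \ae mu, (a *: u : L2) x = a * u x.
Proof. exact: l2reprK. Qed.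

Lemma l2fun_square_integrable (f : l2fun) : square_integrable f.
Proof. by have := l2fun_valP f; rewrite inE. Qed.

Definition L2dot (u v : L2) : R[i] := cintegral (fun x => u x * (v x)^*%C).

Lemma cmeasurable_cint f : cintegrable f -> cmeasurable f.
Proof. by case=> /measurable_int/measurable_EFinP ? /measurable_int/measurable_EFinP. Qed.

Let dotI (u v : L2) : cintegrable (fun x => u x * (v x)^*%C).
Proof. by apply: square_integrable_cintegrable; exact: l2fun_square_integrable. Qed.

Let cintZ a f : cintegrable f -> cintegrable (fun x => a * f x).
Proof.
move=> [f1 f2]; have iZ b (h : X -> R) : mu.-integrable setT (EFin \o h) ->
    mu.-integrable setT (EFin \o (fun x => b * h x)).
  by move=> ih; apply: eq_integrable (integrableZl _ b ih).
split.
  by apply: eq_integrable (integrableB _ (iZ (complex.Re a) _ f1)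
    (iZ (complex.Im a) _ f2)) => // x _ /=; rewrite ReM.
by apply: eq_integrable (integrableD _ (iZ (complex.Re a) _ f2)
  (iZ (complex.Im a) _ f1)) => // x _ /=; rewrite ImM.
Qed.

Fact L2dotC u v : L2dot u v = (-1) ^+ false * (L2dot v u)^*.
Proof.
rewrite expr0 mul1r -[RHS]/((L2dot v u)^*%C) -cintegral_conj//.
by congr cintegral; apply/funext => x; rewrite rmorphM /= conjcK mulrC.
Qed.

Fact L2dot_linear v : linear_for *%R (L2dot^~ v).
Proof.
move=> a u1 u2; rewrite /L2dot -cintegralZ// -cintegralD//; last exact: cintZ.
apply: ae_eq_cintegral.
- exact: cmeasurable_cint.
- by apply: cmeasurable_cint; apply: cintegrableD => //; exact: cintZ.
- apply: filterS2 (l2reprD (a *: u1) u2) (l2reprZ a u1) => x -> ->.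
  by rewrite mulrDl mulrA.
Qed.

Fact L2dot_semilinear u : linear_for (Num.conj \; *%R) (L2dot u).
Proof.
move=> a v1 v2; rewrite (L2dotC u) (L2dotC u v1) (L2dotC u v2) !expr0 !mul1r.
by rewrite L2dot_linear rmorphD rmorphM.
Qed.

HB.instance Definition _ := bilinear_isBilinear.Build R[i] L2 L2 R[i]
  ( *%R : GRing.Scale.law _ _) (Num.conj \; *%R : GRing.Scale.law _ _)
  L2dot (L2dot_linear, L2dot_semilinear).
HB.instance Definition _ :=
  isHermitianSesquilinear.Build R[i] L2 false Num.conj L2dot L2dotC.

Lemma L2dotE u : L2dot u u = (\int[mu]_x sqmod (u x))%:C.
Proof.
apply: complex_ext => /=.
  by apply: eq_Rintegral => x _; rewrite ReM ReJ ImJ mulrN opprK.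
rewrite (_ : (fun x => _) = cst 0) ?Rintegral_cst ?mul0r//.
by apply/funext => x /=; rewrite ImM ReJ ImJ mulrN mulrC addNr.
Qed.

Fact L2dot_gt0 (u : L2) : u != 0 -> 0 < L2dot u u.
Proof.
move=> u0; rewrite L2dotE ltcR lt_def Rintegral_ge0 ?andbT; last first.
  by move=> x _; rewrite addr_ge0 ?sqr_ge0.
apply: contra u0 => /eqP i0; have [[m1 m2] iu] := l2fun_square_integrable u.
have mS : measurable_fun setT (fun x => (sqmod (u x))%:E).
  by apply/measurable_EFinP; apply: measurable_funD; exact: measurable_funX.
have S0 x : (0 <= (sqmod (u x))%:E)%E by rewrite lee_fin addr_ge0 ?sqr_ge0.
have : (\int[mu]_x `|(sqmod (u x))%:E| = 0)%E.
  under eq_integral do rewrite gee0_abs//.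
  rewrite -[LHS]fineK; first by congr EFin; exact: i0.
  by rewrite ge0_fin_numE// integral_ge0.
move=> /(ae_eq_integral_abs mu measurableT mS) uae.
rewrite -[u]reprK -L2_pi0; apply/eqP/L2_eqP; apply: filterS uae => x /(_ I) [/eqP].
rewrite paddr_eq0 ?sqr_ge0// !sqrf_eq0 => /andP[/eqP a /eqP b].
exact: complex_ext.
Qed.
HB.instance Definition _ := isDotProduct.Build R[i] L2 L2dot L2dot_gt0.
End complex_valued_functions.
Arguments L2dot {d X R} mu u v.

Section weighted_composition.
Context (d : measure_display) (X : measurableType d) (R : realType).
Variable mu : {measure set X -> \bar R}.
Implicit Types (w : X -> R[i]) (phi : X -> X) (f Ef g h : X -> \bar R).

Definition weighted_measure w : set X -> \bar R :=
  fun D => (\int[mu]_(x in D) (sqmod (w x))%:E)%E.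

(* Independent of the representatives in L2 as soon as
   pushforward (weighted_measure w) phi `<< mu. *)
Definition weighted_composition phi w : set (L2 mu * L2 mu) :=
  [set p : L2 mu * L2 mu | \forall x \ae mu, p.2 x = w x * p.1 (phi x)].

Definition is_RN_derivative (nu : set X -> \bar R) h :=
  [/\ measurable_fun setT h, forall x, (0 <= h x)%E
    & forall D, measurable D -> nu D = (\int[mu]_(x in D) h x)%E].

(* Ef is the conditional expectation of f >= 0 with respect to the sigma-algebra
   of all phi^-1(D), D measurable, and the measure [weighted_measure w]. *)
Definition is_conditional_expectation phi w f Ef :=
  [/\ forall B : set (\bar R), measurable B ->
        preimage_set_system setT phi measurable (Ef @^-1` B),
      forall x, (0 <= Ef x)%E
    & forall D, measurable D ->
        (\int[weighted_measure w]_(x in phi @^-1` D) Ef x =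
         \int[weighted_measure w]_(x in phi @^-1` D) f x)%E].

(* g is the function usually denoted Ef o phi^-1. *)
Definition is_condexp_pullback phi w h Ef g :=
  [/\ measurable_fun setT g, forall x, (0 <= g x)%E,
      \forall x \ae weighted_measure w, Ef x = g (phi x)
    & \forall x \ae mu, g x = (g x * (\1_[set y | (0 < h y)%E] x)%:E)%E].

(* The values of h and h o phi are almost everywhere finite where they matter,
   and h o phi > 0 almost everywhere on {w <> 0}. *)
Definition is_transformed_weight phi w h (a : R) (wa : X -> R[i]) :=
  cmeasurable wa /\
  \forall x \ae mu,
    wa x = w x * ((fine (h x) / fine (h (phi x))) `^ (a / 2))%:C.

End weighted_composition.

(* Main.v *)
(* Write k for the square root of h. A change of variables turns the integral of
   |w|^2 (F o phi) into that of F h, so that C_{phi,w} and the operator P of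
   multiplication by k have the same domain and satisfy <C u, C v> = <P u, P v>;
   hence C^* C = P^* P = P^2 and |C| = P. The partial isometry is
   U u = w (u o phi) / (k o phi), and |C|^s is multiplication by k^s.
   Pointwise k^a w (k o phi)^-1 (k o phi)^(1 - a) = w_a, so the Aluthge transform
   is the restriction of C_{phi,w_a} to the domain of k^(1 - a). Conditioning
   gives that the integral of |w_a (u o phi)|^2 is that of
   (E(h^a) o phi^-1) h^(1 - a) |u|^2, and (iv), the weakest of the four
   conditions, is what is needed to bound the integral of h^(1 - a) |u|^2 by this
   quantity and the norm of u. *)
Require Import Defs.
From HB Require Import structures.
From mathcomp Require Import all_boot all_order all_algebra sesquilinear.
From mathcomp Require Import all_classical all_reals all_analysis.
From mathcomp Require Import measurable_realfun ess_sup_inf complex.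
From mathcomp Require Import ring.
Set Implicit Arguments.
Unset Strict Implicit.
Unset Printing Implicit Defensive.
Import Order.TTheory GRing.Theory Num.Theory.
Import numFieldNormedType.Exports.
Local Open Scope classical_set_scope.
Local Open Scope complex_scope.
Local Open Scope ring_scope.

(** * Change of variables and weighted measures *)

(** An element of [L2 mu] is a class with a chosen representative, so identities hold only almost
    everywhere, while phi may pull a null set back to a set of positive measure. Up to a null set
    this happens only inside {w = 0}, since |w|^2 mu vanishes on such a preimage. Almost everywhere
    statements are therefore carried along phi under the guard [w x != 0], and every formula is
    arranged to be trivial where w = 0. The same guard makes the division by k o phi legitimate.

    Powers of |C| are spectral integrals, so a spectral measure has to be exhibited: E(S) multiplies
    by the indicator of k^-1(S). Since k is unbounded, test vectors are obtained by truncating to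
    {|k| <= n}; they yield dense domains, selfadjointness and the recovery of an operator from its
    form.

    Dense definedness makes h finite almost everywhere, so that [fine (h x)] can replace it. For (i)
    => (ii), the bound h^a >= c^a under mu_w has to become a bound on g under mu; this is done by
    integrating (c^a - g) h over pieces of {g < c^a} on which the integrals are finite. *)

Section density.
Context d1 d2 (X : measurableType d1) (Y : measurableType d2) (R : realType).
Variables (m1 : {measure set X -> \bar R}) (m2 : {measure set Y -> \bar R}).
Variables (f : X -> Y) (rho : X -> \bar R) (eta : Y -> \bar R).
Hypotheses (mf : measurable_fun setT f).
Hypotheses (mrho : measurable_fun setT rho) (rho0 : forall x, (0 <= rho x)%E).
Hypotheses (meta : measurable_fun setT eta) (eta0 : forall y, (0 <= eta y)%E).
Hypothesis rho_eta : forall D, measurable D ->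
  (\int[m1]_(x in f @^-1` D) rho x = \int[m2]_(y in D) eta y)%E.
Local Open Scope ereal_scope.
Import HBNNSimple.

Let integral_nnsfunM (F : {nnsfun Y >-> R}) :
  \int[m1]_x ((F (f x))%:E * rho x) = \int[m2]_y ((F y)%:E * eta y).
Proof.
have mF r : measurable (F @^-1` [set r]) by exact: measurable_sfunP.
have mI r : measurable_fun setT (fun y => (r * \1_(F @^-1` [set r]) y)%:E).
  by apply/measurable_EFinP; exact: measurable_funM.
have I0 r y : 0 <= (r * \1_(F @^-1` [set r]) y)%:E.
  exact: nnfun_muleindic_ge0.
transitivity (\int[m1]_x \sum_(r \in range F)
    ((r * \1_(F @^-1` [set r]) (f x))%:E * rho x)).
  apply: eq_integral => x _; rewrite -ge0_mule_fsuml//.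
  by rewrite fsumEFin// -(fimfunE _ (f x)).
transitivity (\int[m2]_y \sum_(r \in range F)
    ((r * \1_(F @^-1` [set r]) y)%:E * eta y)); last first.
  apply: eq_integral => x _; rewrite -ge0_mule_fsuml//.
  by rewrite fsumEFin// -(fimfunE _ x).
rewrite !ge0_integral_fsum//; first last.
- by move=> r x _; apply: mule_ge0.
- by move=> r; apply: emeasurable_funM => //; exact: measurableT_comp (mI r) mf.
- by move=> r y _; apply: mule_ge0.
- by move=> r; exact: emeasurable_funM (mI r) meta.
(* Writing the coefficient as a value [F y0] gives its nonnegativity; what remains is the hypothesis
   on one level set. *)
apply: eq_fsbigr => _ /[!inE] -[y0 _ <-].
under eq_integral do rewrite EFinM -muleA.
under [RHS]eq_integral do rewrite EFinM -muleA.
have mA : measurable_fun setT (fun y => (\1_(F @^-1` [set F y0]) y : R)%:E).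
  by apply/measurable_EFinP; exact: measurable_indic.
have I1 y : 0 <= (\1_(F @^-1` [set F y0]) y : R)%:E by rewrite lee_fin.
rewrite (@ge0_integralZl _ _ _ m1)//; last 3 first.
- exact: emeasurable_funM (measurableT_comp mA mf) mrho.
- by move=> x _; exact: mule_ge0.
- by rewrite lee_fin.
rewrite (@ge0_integralZl _ _ _ m2)//; last 3 first.
- exact: emeasurable_funM mA meta.
- by move=> x _; exact: mule_ge0.
- by rewrite lee_fin.
congr (_ * _).
have IA d (T : measurableType d) (m : {measure set T -> \bar R}) (A : set T)
    (h : T -> \bar R) : \int[m]_x ((\1_A x)%:E * h x) = \int[m]_(x in A) h x.
  rewrite [RHS]integral_mkcond; apply: eq_integral => x _.
  by rewrite patchE indicE; case: ifPn; rewrite ?mul1e ?mul0e.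
rewrite [RHS]IA -rho_eta// -[RHS]IA; apply: eq_integral => x _.
by rewrite !indicE.
Qed.

(** The hypothesis is the case of an indicator [F]; simple functions follow by linearity, the others
    by monotone convergence. *)
Lemma ge0_integral_density (F : Y -> \bar R) : measurable_fun setT F ->
  (forall y, 0 <= F y) ->
  \int[m1]_x (F (f x) * rho x) = \int[m2]_y (F y * eta y).
Proof.
move=> mF F0; pose G := nnsfun_approx measurableT mF.
have cvgG (z : \bar R) y : 0 <= z ->
    (G n y)%:E * z @[n --> \oo] --> F y * z.
  move=> z0; have cG : (G n y)%:E @[n --> \oo] --> F y by exact:
    cvg_nnsfun_approx.
  (* Multiplication is discontinuous at 0 times infinity, so a zero factor is treated apart; if
     [F y] is 0, so are its approximations from below. *)
  have [F00|Fy0] := eqVneq (F y) 0.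
    rewrite F00 mul0e; apply: cvg_near_cst; apply: nearW => n.
    suff -> : (G n y)%:E = 0 by rewrite mul0e.
    apply/eqP; rewrite eq_le; apply/andP; split; last by rewrite lee_fin.
    by rewrite -F00 nnsfun_approxE le_approx.
  have [->|zn0] := eqVneq z 0.
    by rewrite mule0; apply: cvg_near_cst; apply: nearW => n; rewrite mule0.
  apply: cvgeM => //; last exact: cvg_cst.
  by apply: neq0_mule_def; rewrite mule_neq0.
have ndG y (z : \bar R) : 0 <= z ->
    {homo (fun n => (G n y)%:E * z) : a b / (a <= b)%N >-> a <= b}.
  by move=> z0 a b ab; rewrite lee_wpmul2r// lee_fin;
    exact/lefP/nd_nnsfun_approx.
transitivity (limn (fun n => \int[m1]_x ((G n (f x))%:E * rho x))).
  rewrite -monotone_convergence//.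
  - by apply: eq_integral => x _; apply/esym/cvg_lim => //; exact: cvgG.
  - move=> n; apply: emeasurable_funM => //; apply/measurable_EFinP.
    exact: measurableT_comp.
  - by move=> n x _; rewrite mule_ge0// lee_fin.
  - by move=> x _; exact: ndG.
transitivity (limn (fun n => \int[m2]_y ((G n y)%:E * eta y))).
  by under eq_fun do rewrite integral_nnsfunM.
rewrite -monotone_convergence//.
- by apply: eq_integral => x _; apply/cvg_lim => //; exact: cvgG.
- by move=> n; apply: emeasurable_funM => //; apply/measurable_EFinP.
- by move=> n x _; rewrite mule_ge0// lee_fin.
- by move=> x _; exact: ndG.
Qed.

End density.

(** Positive and negative parts are transformed separately; the two sides are then the same
    difference, even if both parts are infinite. *)
Lemma integral_density d1 d2 (X : measurableType d1) (Y : measurableType d2)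
    (R : realType) (m1 : {measure set X -> \bar R}) (m2 : {measure set Y ->
      \bar R})
    (f : X -> Y) (rho : X -> R) (eta F : Y -> R) :
  measurable_fun setT f ->
  measurable_fun setT rho -> (forall x, 0 <= rho x) ->
  measurable_fun setT eta -> (forall y, 0 <= eta y) ->
  (forall D, measurable D ->
    \int[m1]_(x in f @^-1` D) (rho x)%:E = \int[m2]_(y in D) (eta y)%:E)%E ->
  measurable_fun setT F ->
  (\int[m1]_x (F (f x) * rho x)%:E = \int[m2]_y (F y * eta y)%:E)%E.
Proof.
move=> mf mrho rho0 meta eta0 rho_eta mF.
have mFE : measurable_fun setT (EFin \o F) by exact/measurable_EFinP.
have mrhoE : measurable_fun setT (EFin \o rho) by exact/measurable_EFinP.
have metaE : measurable_fun setT (EFin \o eta) by exact/measurable_EFinP.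
have dens := ge0_integral_density mf mrhoE rho0 metaE eta0 rho_eta.
have posM (T : Type) (u v : T -> R) : (forall x, 0 <= v x) ->
    ((fun x => (u x * v x)%:E)^\+ = (fun x => (EFin \o u)^\+ x * (v x)%:E))%E.
  by move=> v0; apply/funext => x; rewrite !funeposE /= -!EFin_max -EFinM
    maxr_pMl// mul0r.
have negM (T : Type) (u v : T -> R) : (forall x, 0 <= v x) ->
    ((fun x => (u x * v x)%:E)^\- = (fun x => (EFin \o u)^\- x * (v x)%:E))%E.
  move=> v0; apply/funext => x; rewrite !funenegE /= -!EFin_max -EFinM.
  by rewrite maxr_pMl// mul0r mulNr.
rewrite [LHS]integralE [RHS]integralE (posM _ F eta)// (negM _ F eta)//.
rewrite (posM _ (F \o f) rho)// (negM _ (F \o f) rho)//.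
rewrite -(dens _ (measurable_funepos mFE))//.
rewrite -(dens _ (measurable_funeneg mFE))//.
by congr (_ - _)%E; apply: eq_integral => x _; rewrite ?funeposE ?funenegE.
Qed.

Lemma ae_and d (X : measurableType d) (R : realType)
    (mu : {measure set X -> \bar R}) (P Q : X -> Prop) :
  (\forall x \ae mu, P x) -> (\forall x \ae mu, Q x) ->
  \forall x \ae mu, P x /\ Q x.
Proof. exact: filterI. Qed.

Section cmeasurable.
Context (d : measure_display) (X : measurableType d) (R : realType).
Implicit Types (f g w : X -> R[i]) (r : X -> R) (z t : R[i]).

Lemma sqmod_ge0 z : 0 <= sqmod z.
Proof. by rewrite addr_ge0 ?sqr_ge0. Qed.

Lemma sqmodM z t : sqmod (z * t) = sqmod z * sqmod t.
Proof. by rewrite /sqmod Defs.ReM Defs.ImM; ring. Qed.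

Lemma sqmod_real (x : R) : sqmod x%:C = x ^+ 2.
Proof. by rewrite /sqmod /= expr0n addr0. Qed.

Lemma sqmod_eq0 z : (sqmod z == 0) = (z == 0).
Proof.
rewrite paddr_eq0 ?sqr_ge0// !sqrf_eq0; case: z => a b /=.
by rewrite eq_complex.
Qed.

Lemma measurable_sqmod f : cmeasurable f ->
  measurable_fun setT (fun x => sqmod (f x)).
Proof. by move=> [f1 f2]; apply: measurable_funD; exact: measurable_funX. Qed.

Lemma emeasurable_sqmod f : cmeasurable f ->
  measurable_fun setT (fun x => (sqmod (f x))%:E).
Proof. by move=> /measurable_sqmod mf; exact/measurable_EFinP. Qed.

Lemma cmeasurable_real r : measurable_fun setT r ->
  cmeasurable (fun x => (r x)%:C).
Proof. by move=> mr; split => //=; exact: measurable_cst. Qed.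

Lemma cmeasurableM f g : cmeasurable f -> cmeasurable g ->
  cmeasurable (fun x => f x * g x).
Proof.
move=> [f1 f2] [g1 g2]; split.
  rewrite (_ : (fun x => _) = (fun x => complex.Re (f x) * complex.Re (g x)) \-
      (fun x => complex.Im (f x) * complex.Im (g x))).
    by apply: measurable_funB; exact: measurable_funM.
  by apply/funext => x; rewrite Defs.ReM.
rewrite (_ : (fun x => _) = (fun x => complex.Re (f x) * complex.Im (g x)) \+
    (fun x => complex.Im (f x) * complex.Re (g x))).
  by apply: measurable_funD; exact: measurable_funM.
by apply/funext => x; rewrite Defs.ImM.
Qed.

Lemma cmeasurable_comp f (phi : X -> X) : measurable_fun setT phi ->
  cmeasurable f -> cmeasurable (fun x => f (phi x)).
Proof.
move=> mphi [f1 f2].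
by split; [exact: measurableT_comp f1 mphi|exact: measurableT_comp f2 mphi].
Qed.

End cmeasurable.

Section weighted_measure.
Context (d : measure_display) (X : measurableType d) (R : realType).
Variable mu : {measure set X -> \bar R}.
Variable w : X -> R[i].
Hypothesis mw : cmeasurable w.
Local Open Scope ereal_scope.

(** [weighted_measure] is a bare set function; this packs it as a measure, with an equation to
    rewrite between the two. *)
Lemma weighted_measure_measure :
  {m : {measure set X -> \bar R} | m = weighted_measure mu w :> (set X -> \bar
    R)}.
Proof.
have w0 : weighted_measure mu w set0 = 0 by rewrite /weighted_measure
  integral_set0.
have w_ge0 A : 0 <= weighted_measure mu w A.
  by apply: integral_ge0 => x _; rewrite lee_fin sqmod_ge0.
have w_sigma : semi_sigma_additive (weighted_measure mu w).
  apply: semi_sigma_additive_nng_induced; first exact: emeasurable_sqmod.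
  by move=> x; rewrite lee_fin sqmod_ge0.
pose m : {measure set X -> \bar R} := HB.pack (weighted_measure mu w)
  (isMeasure.Build _ _ _ (weighted_measure mu w) w0 w_ge0 w_sigma).
by exists m.
Qed.

Lemma integral_weighted_measure (F : X -> \bar R) (D : set X) : measurable D ->
  measurable_fun setT F -> (forall x, 0 <= F x) ->
  \int[weighted_measure mu w]_(x in D) F x =
  \int[mu]_(x in D) (F x * (sqmod (w x))%:E).
Proof.
move=> mD mF F0; have [m mE] := weighted_measure_measure; rewrite -mE.
rewrite integral_mkcond [RHS]integral_mkcond.
have mFD : measurable_fun setT (F \_ D).
  by apply/(measurable_restrictT _ mD).1; exact: measurable_funTS.
rewrite (eq_integral (fun x => (F \_ D) x * 1)); last by move=> x _;
  rewrite mule1.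
have mS := emeasurable_sqmod mw.
have S0 x : 0 <= (sqmod (w x))%:E by rewrite lee_fin sqmod_ge0.
have F0D x : 0 <= (F \_ D) x by rewrite patchE; case: ifP.
(* Change of variables along the identity, with density 1 on one side and |w|^2 on the other. *)
have mD1 A : measurable A ->
    \int[m]_(x in idfun @^-1` A) cst 1 x = \int[mu]_(y in A) (sqmod (w y))%:E.
  by move=> mA; rewrite integral_cst// mul1e mE.
rewrite (ge0_integral_density _ _ _ _ _ mD1)//; last exact: measurable_id.
apply: eq_integral => x _; rewrite !patchE; case: ifPn => // _.
by rewrite mul0e.
Qed.

(** If |w|^2 has integral 0 over the exceptional set, then w = 0 almost everywhere on it. *)
Lemma ae_weighted_measure (Q : X -> Prop) :
  (\forall x \ae weighted_measure mu w, Q x) ->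
  \forall x \ae mu, w x != 0%R -> Q x.
Proof.
move=> [N [mN N0 sN]].
have : (\int[mu]_(x in N) `|(sqmod (w x))%:E| = 0).
  by under eq_integral do rewrite gee0_abs ?lee_fin ?sqmod_ge0//.
move=> /(ae_eq_integral_abs mu mN (measurable_funTS (emeasurable_sqmod mw))).
apply: filterS => x /= Nx wx; apply: contrapT => nQ.
have /Nx[/eqP] : N x by exact: sN.
by rewrite sqmod_eq0 (negPf wx).
Qed.

(** This is where absolute continuity makes composition with [phi] independent of
    representatives. *)
Lemma ae_comp (phi : X -> X) (Q : X -> Prop) : measurable_fun setT phi ->
  pushforward (weighted_measure mu w) phi `<< mu ->
  (\forall x \ae mu, Q x) -> \forall x \ae mu, w x != 0%R -> Q (phi x).
Proof.
move=> mphi /null_content_dominatesP w_mu [N [mN N0 sN]].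
apply: ae_weighted_measure; exists (phi @^-1` N); split.
- by rewrite -[_ @^-1` _]setTI; exact: mphi.
- exact: (w_mu _ mN N0).
- by move=> x /= nQ; exact: sN.
Qed.

End weighted_measure.

(** * Square integrable functions *)

Section L2_representatives.
Context (d : measure_display) (X : measurableType d) (R : realType).
Variable mu : {measure set X -> \bar R}.
Implicit Types (f g w : X -> R[i]) (r : X -> R) (u v : L2 mu).

Definition toL2 f : L2 mu :=
  if pselect (square_integrable mu f) is left p
  then \pi_(L2 mu)%qT (L2fun (mem_set p)) else 0.

Lemma toL2E f : square_integrable mu f -> \forall x \ae mu, toL2 f x = f x.
Proof. by move=> p; rewrite /toL2; case: pselect => // q; exact: l2reprK. Qed.

Lemma L2_ext u v : (\forall x \ae mu, u x = v x) -> u = v.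
Proof. by move=> uv; rewrite -[u]reprK -[v]reprK; exact/L2_eqP. Qed.

Lemma L2_cmeasurable u : cmeasurable u.
Proof. by case: (l2fun_square_integrable u). Qed.

Lemma L2_integral_lty u : (\int[mu]_x (sqmod (u x))%:E < +oo)%E.
Proof. by case: (l2fun_square_integrable u). Qed.

Lemma square_integrable_le f g (M : R) : cmeasurable g ->
  square_integrable mu f -> (\forall x \ae mu, sqmod (g x) <= M * sqmod (f x))
    ->
  square_integrable mu g.
Proof.
move=> mg [mf fi] gf; split=> //.
have M0 : 0 <= Num.max M 0 by rewrite le_max lexx orbT.
apply: (@le_lt_trans _ _ (\int[mu]_x ((Num.max M 0)%:E * (sqmod (f x))%:E))%E).
  apply: ae_ge0_le_integral => //.
  - by move=> x _; rewrite lee_fin sqmod_ge0.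
  - exact: emeasurable_sqmod.
  - by move=> x _; rewrite mule_ge0 ?lee_fin ?sqmod_ge0.
  - by apply: measurable_funeM; exact: emeasurable_sqmod.
  - apply: filterS gf => x gf _; rewrite -EFinM lee_fin (le_trans gf)//.
    by rewrite ler_wpM2r ?sqmod_ge0// le_max lexx.
rewrite ge0_integralZl//.
- by rewrite lte_mul_pinfty.
- exact: emeasurable_sqmod.
- by move=> x _; rewrite lee_fin sqmod_ge0.
Qed.

Lemma square_integrable_ae f g : cmeasurable g -> square_integrable mu f ->
  (\forall x \ae mu, g x = f x) -> square_integrable mu g.
Proof.
move=> mg fi gf; apply: (square_integrable_le (M := 1) mg fi).
by apply: filterS gf => x ->; rewrite mul1r.
Qed.

Lemma L2dot_ae u v u' v' :
  (\forall x \ae mu, u x * (v x)^*%C = u' x * (v' x)^*%C) ->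
  L2dot mu u v = L2dot mu u' v'.
Proof.
move=> E; apply: ae_eq_cintegral => //; apply: (@cmeasurable_cint _ _ _ mu);
  by apply: square_integrable_cintegrable; exact: l2fun_square_integrable.
Qed.

(** Symmetry of real multiplication, phrased with graph pairs so that it covers unbounded [r]. *)
Lemma L2dot_mulC r u v u' v' :
  (\forall x \ae mu, u' x = (r x)%:C * u x) ->
  (\forall x \ae mu, v' x = (r x)%:C * v x) ->
  L2dot mu u' v = L2dot mu u v'.
Proof.
move=> Eu Ev; apply: L2dot_ae; apply: filterS2 Eu Ev => x -> ->.
have conjM z t : (z * t)^*%C = z^*%C * t^*%C :> R[i] by exact: rmorphM.
by rewrite conjM conjc_real mulrCA mulrA.
Qed.

Lemma L2dot_mul r u v : (\forall x \ae mu, v x = (r x)%:C * u x) ->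
  measurable_fun setT r ->
  L2dot mu v u = (\int[mu]_x (r x * sqmod (u x)))%:C.
Proof.
move=> vE mr; have mcu := L2_cmeasurable u; have mv := L2_cmeasurable v.
have mruu : measurable_fun setT (fun x => r x * sqmod (u x)).
  by apply: measurable_funM => //; exact: measurable_sqmod.
transitivity (cintegral mu (fun x => (r x * sqmod (u x))%:C)).
  apply: ae_eq_cintegral.
  - apply: (@cmeasurable_cint _ _ _ mu).
    by apply: square_integrable_cintegrable; exact: l2fun_square_integrable.
  - exact: cmeasurable_real.
  - apply: filterS vE => x ->; apply: complex_ext; rewrite !(Defs.ReM, Defs.ImM)
      ?Defs.ReJ ?Defs.ImJ /= /sqmod; ring.
apply: complex_ext => //=.
by rewrite Rintegral_cst//= mul0r.
Qed.

Lemma L2dot_eq0 u : L2dot mu u u = 0 -> u = 0.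
Proof.
move=> u0; apply/eqP; apply: contraT => /L2dot_gt0.
by rewrite u0 ltxx.
Qed.

Lemma op_dom_weighted_composition phi w u :
  measurable_fun setT phi -> cmeasurable w ->
  op_dom (weighted_composition phi w : set (L2 mu * L2 mu)) u <->
  square_integrable mu (fun x => w x * u (phi x)).
Proof.
move=> mphi mw; have mwu : cmeasurable (fun x => w x * u (phi x)).
  apply: cmeasurableM => //; apply: cmeasurable_comp => //;
    exact: L2_cmeasurable.
split=> [[v /= vE]|wu].
  apply: (square_integrable_ae mwu (l2fun_square_integrable (v : L2 mu))).
  by apply: filterS vE => x ->.
by exists (toL2 (fun x => w x * u (phi x))); exact: toL2E.
Qed.

(** The representative of [a *: u + v] is the expected combination only almost everywhere; the third
    hypothesis transports this along [phi] off {w = 0}, and on {w = 0} both sides vanish. *)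
Lemma linear_weighted_composition phi w :
  measurable_fun setT phi -> cmeasurable w ->
  (forall Q : X -> Prop, (\forall x \ae mu, Q x) ->
     \forall x \ae mu, w x != 0 -> Q (phi x)) ->
  (forall u, square_integrable mu (fun x => w x * u (phi x))) ->
  exists U : {linear L2 mu -> L2 mu},
    forall u, \forall x \ae mu, (U u : L2 mu) x = w x * u (phi x).
Proof.
move=> mphi mw ae_phi wi; pose U u : L2 mu := toL2 (fun x => w x * u (phi x)).
have UE u : \forall x \ae mu, U u x = w x * u (phi x) by exact: toL2E.
have lU : linear U.
  move=> a u v; apply: L2_ext.
  have aeD := ae_phi _ (ae_and (l2reprD (a *: u) v) (l2reprZ a u)).
  have aeUD := ae_and (l2reprD (a *: U u) (U v)) (l2reprZ a (U u)).
  apply: filterS3 aeUD (ae_and (UE u) (UE v)) (ae_and (UE (a *: u + v)) aeD).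
  move=> x [-> ->] [-> ->] [->].
  have [->|_ /(_ isT)[-> ->]] := eqVneq (w x) 0;
    first by rewrite !mul0r mulr0 addr0.
  by rewrite mulrDr mulrCA.
pose V : {linear L2 mu -> L2 mu} := HB.pack U (GRing.isLinear.Build _ _ _ _ U
  lU).
by exists V.
Qed.

End L2_representatives.

(** * Multiplication operators *)

Section multiplication_operators.
Context (d : measure_display) (X : measurableType d) (R : realType).
Variable mu : {measure set X -> \bar R}.
Implicit Types (r k : X -> R) (u v : L2 mu).

Definition multiplication k : set (L2 mu * L2 mu) :=
  weighted_composition idfun (fun x => (k x)%:C).

(** The source of test vectors: each cutoff lies in the domain of multiplication by [k], and the
    sets where it agrees with [u] exhaust the space. *)
Definition cutoff k (n : nat) u : L2 mu :=
  toL2 mu (fun x => (\1_[set y | `|k y| <= n%:R] x)%:C * u x).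

Lemma l2reprB u v : \forall x \ae mu, (u - v : L2 mu) x = u x - v x.
Proof.
by apply: filterS (l2reprD (u - v) v) => x; rewrite subrK => ->; rewrite addrK.
Qed.

Lemma L2dotBr u v w : L2dot mu u (v - w) = L2dot mu u v - L2dot mu u w.
Proof. exact: linearBr. Qed.

Lemma measurable_cutoff k n : measurable_fun setT k ->
  measurable [set y | `|k y| <= n%:R].
Proof.
move=> mk; rewrite (_ : [set y | _] = (fun y => `|k y|) @^-1` `]-oo, n%:R]).
  by rewrite -[_ @^-1` _]setTI; apply: (measurableT_comp _ mk).
by apply/seteqP; split => y /=; rewrite in_itv.
Qed.

Lemma op_dom_multiplication k u : measurable_fun setT k ->
  op_dom (multiplication k) u <->
  square_integrable mu (fun x => (k x)%:C * u x).
Proof.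
move=> mk; apply: op_dom_weighted_composition; first exact: measurable_id.
exact: cmeasurable_real.
Qed.

Lemma square_integrable_mulb r u (M : R) : measurable_fun setT r ->
  (forall x, `|r x| <= M) -> square_integrable mu (fun x => (r x)%:C * u x).
Proof.
move=> mr rM; apply: (square_integrable_le (f := u) (M := M ^+ 2)).
- by apply: cmeasurableM; [exact: cmeasurable_real|exact: L2_cmeasurable].
- exact: l2fun_square_integrable.
- apply: aeW => x; rewrite sqmodM sqmod_real ler_wpM2r ?sqmod_ge0//.
  by rewrite -[r x ^+ 2]real_normK ?num_real// lerXn2r ?nnegrE// (le_trans _
    (rM x)).
Qed.

Section cutoff.
Variable k : X -> R.
Hypothesis mk : measurable_fun setT k.

Lemma cutoffE n u : \forall x \ae mu,
  cutoff k n u x = (\1_[set y | `|k y| <= n%:R] x)%:C * u x.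
Proof.
apply: toL2E; apply: (@square_integrable_mulb _ _ 1).
  by apply: measurable_indic; exact: measurable_cutoff.
by move=> x; rewrite indicE; case: (_ \in _); rewrite ?normr1 ?normr0 ?ler01.
Qed.

Let kn n x := k x * \1_[set y | `|k y| <= n%:R] x.

Let mkn (n : nat) : measurable_fun setT (kn n).
Proof.
by apply: measurable_funM => //; apply: measurable_indic;
  exact: measurable_cutoff.
Qed.

Lemma cutoff_mulE n u : \forall x \ae mu,
  (toL2 mu (fun x => (kn n x)%:C * u x)) x = (kn n x)%:C * u x.
Proof.
apply: toL2E; apply: (@square_integrable_mulb _ _ n%:R) => // x.
rewrite /kn indicE; case: (asboolP ([set y | `|k y| <= n%:R] x)) => kx.
  by rewrite mem_set// mulr1.
by rewrite memNset// mulr0 normr0.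
Qed.

Lemma multiplication_cutoff n u :
  multiplication k (cutoff k n u, toL2 mu (fun x => (kn n x)%:C * u x)).
Proof.
rewrite /multiplication /weighted_composition /=.
apply: filterS2 (cutoffE n u) (cutoff_mulE n u) => x -> ->.
by rewrite /kn mulrA rmorphM.
Qed.

Lemma ae_cutoff (Q : X -> Prop) :
  (forall n : nat, \forall x \ae mu, `|k x| <= n%:R -> Q x) ->
  \forall x \ae mu, Q x.
Proof.
move=> /ae_foralln; apply: filterS => x /(_ (Num.truncn `|k x|).+1); apply.
by rewrite ltW// truncnS_gt.
Qed.

Lemma cutoff_eq0 u : (forall n, cutoff k n u = 0) -> u = 0.
Proof.
move=> u0; apply: L2_ext; apply: ae_cutoff => n.
apply: filterS (cutoffE n u) => x; rewrite u0 => -> kx.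
by rewrite indicE mem_set// mul1r.
Qed.

(** The squared distance from [u] to its cutoff is the mass of {|k| > n} under |u|^2 mu. This
    measure is finite and the sets decrease to the empty set, so continuity from above applies. *)
Lemma multiplication_dense : densely_defined (L2dot mu) (multiplication k).
Proof.
move=> u e e0.
have [m mE] := weighted_measure_measure mu (L2_cmeasurable u).
pose A n := ~` [set y | `|k y| <= n%:R].
have mA n : measurable (A n) by apply: measurableC; exact: measurable_cutoff.
have : m (A n) @[n --> \oo] --> m (\bigcap_n A n).
  apply: nonincreasing_cvg_mu => //.
  - rewrite mE; apply: le_lt_trans (L2_integral_lty u).
    apply: ge0_subset_integral => //.
      by apply: emeasurable_sqmod; exact: L2_cmeasurable.
    by move=> x _; rewrite lee_fin sqmod_ge0.
  - exact: bigcap_measurable.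
  - move=> a b ab; apply/subsetPset => x /= kb ka; apply: kb => /=.
    by rewrite (le_trans ka)// ler_nat.
have -> : \bigcap_n A n = set0.
  rewrite -subset0 => x /(_ (Num.truncn `|k x|).+1 I); apply => /=.
  by rewrite ltW// truncnS_gt.
rewrite measure0 => mA0.
have e20 : (0 < (e ^+ 2)%:E)%E by rewrite lte_fin exprn_gt0.
have [n _ /(_ n (leqnn n)) mAn] : \forall n \near \oo, (m (A n) < (e ^+
  2)%:E)%E.
  exact: mA0 (open_ereal_lt' e20).
exists (cutoff k n u); first by eexists; exact: multiplication_cutoff.
set v : L2 mu := u - cutoff k n u.
rewrite -[ltLHS]/(L2dot mu v v) L2dotE ltcR -lte_fin /Rintegral.
suff -> : (\int[mu]_x (sqmod (v x))%:E)%E = m (A n).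
  rewrite fineK// ge0_fin_numE ?measure_ge0//.
  by rewrite (lt_trans mAn)// ltry.
rewrite mE /weighted_measure [RHS]integral_mkcond;
  apply: ge0_ae_eq_integral => //.
- by apply: emeasurable_sqmod; exact: L2_cmeasurable.
- apply/(measurable_restrictT _ (mA n)).1/measurable_funTS.
  by apply: emeasurable_sqmod; exact: L2_cmeasurable.
- by move=> x _; rewrite lee_fin sqmod_ge0.
- by move=> x _; rewrite patchE; case: ifP => // _; rewrite lee_fin sqmod_ge0.
- apply: filterS2 (l2reprB u (cutoff k n u)) (cutoffE n u) => x -> -> _.
  rewrite patchE /A in_setC indicE; case: (_ \in _) => /=.
    by rewrite mul1r subrr sqmod_real expr0n.
  by rewrite mul0r subr0.
Qed.

End cutoff.

(** For (u, v) in the adjoint, let z be the difference of the truncations of k u and v. Testing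
    against the cutoff of z gives <z, z> = 0, so v = k u on each {|k| <= n}. *)
Lemma multiplication_selfadjoint k : measurable_fun setT k ->
  op_adjoint (L2dot mu) (multiplication k) = multiplication k.
Proof.
move=> mk; apply/seteqP; split => -[u v] /= uv.
  suff kuv n : toL2 mu (fun x => (k x * \1_[set y | `|k y| <= n%:R] x)%:C * (u
    : L2 mu) x) =
      cutoff k n v.
    apply: (@ae_cutoff k) => n; apply: filterS2 (cutoffE mk n v) (cutoff_mulE
      mk n u).
    move=> x /=; rewrite kuv => -> + kx.
    by rewrite indicE mem_set// mulr1 mul1r.
  apply: subr0_eq; set Tu := toL2 mu _; apply: L2dot_eq0.
  set z := _ - _.
  have /= zuv := uv _ (multiplication_cutoff mk n z).
  have E : L2dot mu z Tu = L2dot mu z (cutoff k n v).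
    rewrite -(L2dot_mulC (cutoff_mulE mk n z) (cutoff_mulE mk n u)).
    by rewrite -(L2dot_mulC (cutoffE mk n z) (cutoffE mk n v)).
  by rewrite {2}/z L2dotBr E subrr.
move=> [u' v'] /= u'v'; exact: (L2dot_mulC u'v' uv).
Qed.

End multiplication_operators.

(** * Spectral integrals of multiplication operators *)

Section spectral.
Context (d : measure_display) (X : measurableType d) (R : realType).
Variable mu : {measure set X -> \bar R}.
Variable k : X -> R.
Hypothesis mk : measurable_fun setT k.
Implicit Types (r : X -> R) (u v : L2 mu).

Lemma positive_selfadjoint_multiplication : (forall x, 0 <= k x) ->
  positive_selfadjoint (L2dot mu) (multiplication k).
Proof.
move=> k0; split; [exact: multiplication_dense|exact:
  multiplication_selfadjoint|].
move=> -[u v] /= uv; rewrite -[X in _ <= X]/(L2dot mu v u) (L2dot_mul uv mk).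
rewrite lecR; apply: Rintegral_ge0 => x _.
by rewrite mulr_ge0// sqmod_ge0.
Qed.

Variable E : set R -> {linear L2 mu -> L2 mu}.

(* A nonmeasurable S gets the zero projection: scalar_measure is then a measure,
   nonnegative on every set. *)
Definition spectral_weight (S : set R) x : R :=
  if `[< measurable S >] then \1_S (k x) else 0.

Hypothesis EE : forall S u, \forall x \ae mu,
  (E S u : L2 mu) x = (spectral_weight S x)%:C * u x.

Let mweight S : measurable_fun setT (spectral_weight S).
Proof.
rewrite /spectral_weight; case: asboolP => mS; last exact: measurable_cst.
by apply: measurableT_comp mk; exact: measurable_indic.
Qed.

Let weight_idem S x : spectral_weight S x * spectral_weight S x =
  spectral_weight S x.
Proof.
rewrite /spectral_weight; case: ifP => _; rewrite ?mulr0//.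
by rewrite indicE; case: (_ \in _); rewrite ?mulr0 ?mulr1.
Qed.

Let weight_ge0 S x : 0 <= spectral_weight S x.
Proof. by rewrite /spectral_weight; case: ifP. Qed.

Let E_projection S : orthogonal_projection (L2dot mu) (E S).
Proof.
split=> [u|u v]; last exact: L2dot_mulC (EE S u) (EE S v).
apply: L2_ext; apply: filterS2 (EE S u) (EE S (E S u)) => x -> ->.
by rewrite mulrA -rmorphM /= weight_idem.
Qed.

Let scalar_measureE u S : scalar_measure (L2dot mu) E u S =
  (\int[mu]_x (spectral_weight S x * sqmod (u x))%:E)%E.
Proof.
transitivity ((\int[mu]_x (spectral_weight S x * sqmod (u x)))%:E)%R.
  have H := L2dot_mul (EE S u) (mweight S).
  by congr EFin; apply: (congr1 (@complex.Re R) H).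
rewrite /Rintegral fineK// ge0_fin_numE; last first.
  by apply: integral_ge0 => x _; rewrite lee_fin mulr_ge0// sqmod_ge0.
apply: le_lt_trans (L2_integral_lty u); apply: ge0_le_integral => //.
- by move=> x _; rewrite lee_fin mulr_ge0// sqmod_ge0.
- apply/measurable_EFinP; apply: measurable_funM => //.
  by apply: measurable_sqmod; exact: L2_cmeasurable.
- by apply: emeasurable_sqmod; exact: L2_cmeasurable.
- move=> x _; rewrite lee_fin ler_piMl ?sqmod_ge0//.
  by rewrite /spectral_weight; case: ifP => // _; rewrite indicE;
    case: (_ \in _).
Qed.

Let scalar_measure_pushforward u S : measurable S ->
  scalar_measure (L2dot mu) E u S = pushforward (weighted_measure mu u) k S.
Proof.
move=> mS; rewrite scalar_measureE /pushforward /weighted_measure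
  [RHS]integral_mkcond.
apply: eq_integral => x _; rewrite patchE /spectral_weight asboolT// indicE.
rewrite (_ : (x \in k @^-1` S) = (k x \in S))//.
by case: (_ \in _); rewrite ?mul1r ?mul0r.
Qed.

Let scalar_measure_sigma_additive u :
  semi_sigma_additive (scalar_measure (L2dot mu) E u).
Proof.
have [m mE] := weighted_measure_measure mu (L2_cmeasurable u).
pose K : {mfun X >-> R} := HB.pack k (isMeasurableFun.Build _ _ _ _ k mk).
have sE S : measurable S -> scalar_measure (L2dot mu) E u S = pushforward m K S.
  by move=> mS; rewrite scalar_measure_pushforward// /pushforward mE.
move=> F mF tF mUF; rewrite sE//.
under eq_fun do under eq_bigr do rewrite sE//.
exact: measure_semi_sigma_additive.
Qed.

Lemma spectral_measure_multiplication : spectral_measure (L2dot mu) E.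
Proof.
split=> // u.
apply: L2_ext; apply: filterS (EE setT u) => x ->.
by rewrite /spectral_weight asboolT// indicT mul1r.
Qed.

Let scalar_measure_measure u : exists s : {measure set R -> \bar R},
  s = scalar_measure (L2dot mu) E u :> (set R -> \bar R).
Proof.
have s0 : scalar_measure (L2dot mu) E u set0 = 0%E.
  by rewrite scalar_measure_pushforward// /pushforward preimage_set0
    /weighted_measure integral_set0.
have s_ge0 S : (0 <= scalar_measure (L2dot mu) E u S)%E.
  rewrite scalar_measureE; apply: integral_ge0 => x _.
  by rewrite lee_fin mulr_ge0// sqmod_ge0.
pose s : {measure set R -> \bar R} := HB.pack (scalar_measure (L2dot mu) E u)
  (isMeasure.Build _ _ _ (scalar_measure (L2dot mu) E u) s0 s_ge0
    (scalar_measure_sigma_additive (u := u))).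
by exists s.
Qed.

(** The scalar measure of [u] is the image of |u|^2 mu under [k]. *)
Lemma integral_scalar_measure u (f : R -> R) : measurable_fun setT f ->
  (\int[scalar_measure (L2dot mu) E u]_t (f t)%:E =
   \int[mu]_x (f (k x) * sqmod (u x))%:E)%E.
Proof.
move=> mf; have [s sE] := scalar_measure_measure u; rewrite -sE.
have dens D : measurable D -> (\int[mu]_(x in k @^-1` D) (sqmod (u x))%:E =
    \int[s]_(t in D) (cst 1%R t)%:E)%E.
  by move=> mD; rewrite [RHS](integral_cst s mD 1%E) mul1e sE
    scalar_measure_pushforward.
rewrite (integral_density _ _ _ _ _ dens)//.
- by apply: eq_integral => t _; rewrite mulr1.
- by apply: measurable_sqmod; exact: L2_cmeasurable.
- by move=> x; exact: sqmod_ge0.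
Qed.

Variable f : R -> R.
Hypothesis mf : measurable_fun setT f.

Lemma spectral_domE u : spectral_dom (L2dot mu) E f u <->
  square_integrable mu (fun x => (f (k x))%:C * u x).
Proof.
have mfk := measurableT_comp mf mk.
rewrite /spectral_dom /= integral_scalar_measure; last exact: measurable_funX.
rewrite (eq_integral (fun x => (sqmod ((f (k x))%:C * u x))%:E)); last first.
  by move=> x _; rewrite sqmodM sqmod_real.
split=> [ui|[]//]; split=> //; apply: cmeasurableM (L2_cmeasurable u).
exact: cmeasurable_real.
Qed.

(** Each of the four integrals is an inner product <u' + c v', u + c v>, because multiplication by f
    o k is linear on its domain; polarization then isolates <u', v>. *)
Lemma spectral_formE u v u' v' :
  (\forall x \ae mu, u' x = (f (k x))%:C * u x) ->
  (\forall x \ae mu, v' x = (f (k x))%:C * v x) ->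
  spectral_form (L2dot mu) E f u v = L2dot mu u' v.
Proof.
move=> uE vE; have mfk := measurableT_comp mf mk.
have H c : (fine (\int[scalar_measure (L2dot mu) E (u + c *: v)]_t (f
  t)%:E))%:C =
    L2dot mu (u' + c *: v') (u + c *: v).
  rewrite integral_scalar_measure//.
  rewrite (L2dot_mul (r := f \o k))//.
  apply: filterS3 (ae_and (l2reprD u (c *: v)) (l2reprZ c v))
    (ae_and (l2reprD u' (c *: v')) (l2reprZ c v')) (ae_and uE vE).
  by move=> x [-> ->] [-> ->] [-> ->] /=; ring.
rewrite /spectral_form; under eq_bigr do rewrite H.
(* Over n = 0, ..., 3 the powers of i and of -1 both sum to 0, and only the middle term survives,
   four times. *)
have T (n : nat) : 'i ^+ n * L2dot mu (u' + 'i ^+ n *: v') (u + 'i ^+ n *: v) =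
    'i ^+ n * (L2dot mu u' u + L2dot mu v' v) + L2dot mu u' v +
    (-1) ^+ n * L2dot mu v' u.
  have iJ : 'i ^+ n * ('i ^+ n)^* = 1 :> R[i].
    by rewrite rmorphXn /= -exprMn conjCi mulrN -expr2 sqrCi opprK expr1n.
  have ii : 'i ^+ n * 'i ^+ n = (-1) ^+ n :> R[i] by rewrite -exprMn -expr2
    sqrCi.
  rewrite ![_ + 'i ^+ n *: _]addrC L2dot_linear !L2dot_semilinear /=.
  rewrite -ii; move: iJ; set c := 'i ^+ n; set cJ := c^*.
  move: (L2dot mu u' u) (L2dot mu u' v) (L2dot mu v' u) (L2dot mu v' v) => p q
    r s.
  move=> iJ; transitivity (c * cJ * q + c * p + c * (c * cJ) * s + c * c * r);
    first ring.
  by rewrite iJ; ring.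
under eq_bigr do rewrite T.
rewrite !big_ord_recr big_ord0 /= sqrCi.
rewrite (_ : 'i ^+ 3 = - 'i); last by rewrite exprS sqrCi mulrN1.
by rewrite expr0 expr1; field.
Qed.

(** The form determines the value only through pairings with the domain, so the difference from f(k)
    u is tested against its own cutoffs, which lie in that domain. *)
Lemma spectral_integral_multiplication :
  spectral_integral (L2dot mu) E f = multiplication (f \o k).
Proof.
have mfk := measurableT_comp mf mk.
have domE := op_dom_multiplication (mu := mu) _ mfk.
apply/seteqP; split => -[u v] /=; last first.
  move=> uv; split=> [|v0 /spectral_domE v0i].
    by apply/spectral_domE/domE; exists v.
  by rewrite (spectral_formE uv (toL2E v0i)).
move=> [/spectral_domE ui uv].
have uE := toL2E ui; set fu := toL2 mu _ in uE.
suff -> : v = fu by [].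
apply: subr0_eq; apply: (cutoff_eq0 mfk) => n; apply: L2dot_eq0.
set z : L2 mu := v - fu; set y := cutoff _ n z.
have [y' yy'] : op_dom (multiplication (f \o k)) y.
  by eexists; exact: multiplication_cutoff.
have : L2dot mu v y = L2dot mu fu y.
  by rewrite -(spectral_formE uE yy') -uv//; apply/spectral_domE/domE;
    exists y'.
(* The cutoff indicator is idempotent, hence <y, y> = <z, y>, which is 0. *)
move=> /eqP; rewrite -subr_eq0 => /eqP E0.
rewrite -[RHS]E0 -linearBl.
rewrite -[RHS]/(L2dot mu z y); apply: L2dot_mulC (cutoffE mfk n z) _.
apply: filterS (cutoffE mfk n z) => x; rewrite -/y => ->.
rewrite mulrA -rmorphM /= indicE; congr (_%:C * _).
by case: (_ \in _); rewrite ?mulr0 ?mulr1.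
Qed.

End spectral.

(** Multiplication by the indicator of k^-1(S) is bounded, hence linear on all of [L2 mu]; choice
    collects these maps into one spectral measure, used for both [id] and the power. *)
Lemma multiplication_power d (X : measurableType d) (R : realType)
    (mu : {measure set X -> \bar R}) (k : X -> R) (s : R) : measurable_fun setT
      k ->
  is_op_power (L2dot mu) (multiplication k) s (multiplication (fun x => k x `^
    s)).
Proof.
move=> mk; have /choice[E EE] : forall S, exists ES : {linear L2 mu -> L2 mu},
    forall u : L2 mu, \forall x \ae mu, (ES u : L2 mu) x = (spectral_weight k S
      x)%:C * u x.
  move=> S; have mS : measurable_fun setT (spectral_weight k S).
    rewrite /spectral_weight; case: asboolP => mS; last exact: measurable_cst.
    by apply: measurableT_comp mk; exact: measurable_indic.
  apply: (linear_weighted_composition (phi := idfun)) => //.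
  - exact: measurable_id.
  - by move=> Q; apply: filterS => x ? _.
  - move=> u; apply: (@square_integrable_mulb _ _ _ _ _ _ 1) => // x.
    rewrite /spectral_weight; case: ifP => _; rewrite ?normr0 ?ler01// indicE.
    by case: (_ \in _); rewrite ?normr0 ?normr1 ?ler01.
exists E; split; first exact: (spectral_measure_multiplication mk EE).
- by rewrite (spectral_integral_multiplication mk EE)//.
- by rewrite (spectral_integral_multiplication mk EE)//; exact: measurable_powR.
Qed.

(** * Polar decomposition of a weighted composition operator *)

Lemma measurable_inv_ge0 d (X : measurableType d) (R : realType) (f : X -> R) :
  measurable_fun setT f -> (forall x, 0 <= f x) ->
  measurable_fun setT (fun x => (f x)^-1).
Proof.
move=> mf f0; under eq_fun do rewrite -powR_inv1//.
exact: measurableT_comp (measurable_powR _) mf.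
Qed.

(** The exponents of y agree as -1/2 + (1 - s)/2 = -s/2; adding them uses y != 0, whereas x may
    vanish. *)
Lemma powR_div_half (R : realType) (x y s : R) : 0 <= x -> 0 < y ->
  (x / y) `^ (s / 2) =
  (x `^ 2^-1) `^ s * ((y `^ 2^-1)^-1 * (y `^ 2^-1) `^ (1 - s)).
Proof.
move=> x0 y0; have yn0 : y != 0 by rewrite gt_eqF.
have -> : y^-1 = y `^ (-1) by rewrite powR_inv1 ?ltW.
rewrite powRM ?powR_ge0// -powRN -!powRrM -powRD; last by rewrite yn0 implybT.
by congr (_ `^ _ * _ `^ _); field.
Qed.

Section polar_decomposition.
Context (d : measure_display) (X : measurableType d) (R : realType).
Variable mu : {measure set X -> \bar R}.
Variables (w : X -> R[i]) (phi : X -> X) (H : X -> R).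
Hypotheses (mw : cmeasurable w) (mphi : measurable_fun setT phi).
Hypotheses (mH : measurable_fun setT H) (H0 : forall x, 0 <= H x).
Hypothesis wH : forall D, measurable D ->
  (\int[mu]_(x in phi @^-1` D) (sqmod (w x))%:E = \int[mu]_(x in D) (H x)%:E)%E.
Implicit Types u v : L2 mu.

Let ae_phi (Q : X -> Prop) : (\forall x \ae mu, Q x) ->
  \forall x \ae mu, w x != 0 -> Q (phi x).
Proof.
apply: ae_comp => //; apply/null_content_dominatesP => D mD D0.
rewrite /pushforward /weighted_measure wH//; apply: null_set_integral => //.
exact/measurable_EFinP/measurable_funTS.
Qed.

(** The preimage of {H = 0} has mu_w-measure equal to the integral of H over {H = 0}. *)
Lemma ae_density_gt0 : \forall x \ae mu, w x != 0 -> 0 < H (phi x).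
Proof.
apply: (ae_weighted_measure mw).
have mH0 : measurable (H @^-1` [set 0]) by rewrite -[_ @^-1` _]setTI; exact: mH.
exists (phi @^-1` (H @^-1` [set 0])); split.
- by rewrite -[_ @^-1` _]setTI; exact: mphi.
- rewrite /weighted_measure wH//; apply: integral0_eq => x /= ->//.
- move=> x /= /negP; rewrite lt_def H0 andbT negbK => /eqP//.
Qed.

Let integral_w (F : X -> R) : measurable_fun setT F ->
  (\int[mu]_x (F (phi x) * sqmod (w x))%:E = \int[mu]_x (F x * H x)%:E)%E.
Proof.
apply: integral_density => //; first exact: measurable_sqmod.
by move=> x; exact: sqmod_ge0.
Qed.

Let l2repr0 : \forall x \ae mu, (0 : L2 mu) x = 0.
Proof. by rewrite -L2_pi0; exact: l2reprK. Qed.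

Let measurable_positive : measurable [set x | 0 < H x].
Proof.
rewrite (_ : [set x | _] = H @^-1` `]0, +oo[).
  by rewrite -[_ @^-1` _]setTI; exact: mH.
by apply/seteqP; split => y /=; rewrite in_itv/= andbT.
Qed.

(** A real power rather than [Num.sqrt], so that the exponent 1/2 combines with [a] and [1 - a] by
    the laws of powers. *)
Definition sqrt_density x := H x `^ 2^-1.
Local Notation k := sqrt_density.

Lemma measurable_sqrt_density : measurable_fun setT k.
Proof. exact: measurableT_comp (measurable_powR 2^-1) mH. Qed.

Lemma sqr_sqrt_density x : k x ^+ 2 = H x.
Proof. by rewrite -powR_mulrn ?powR_ge0// -powRrM mulVf// powRr1. Qed.

Lemma sqrt_density_gt0 x : (0 < k x) = (0 < H x).
Proof.
have := sqr_sqrt_density x; have : 0 <= k x by exact: powR_ge0.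
rewrite le_eqVlt => /predU1P[<-|kx] <-; first by rewrite expr0n ltxx.
by rewrite kx exprn_gt0.
Qed.

Let mk := measurable_sqrt_density.
Let C : set (L2 mu * L2 mu) := weighted_composition phi w.
Let P : set (L2 mu * L2 mu) := multiplication k.

Lemma square_integrable_density u :
  square_integrable mu (fun x => w x * u (phi x)) <->
  square_integrable mu (fun x => (k x)%:C * u x).
Proof.
have mcu := L2_cmeasurable u.
have m1 : cmeasurable (fun x => w x * u (phi x)).
  by apply: cmeasurableM => //; exact: cmeasurable_comp.
have m2 : cmeasurable (fun x => (k x)%:C * u x).
  by apply: cmeasurableM => //; exact: cmeasurable_real.
rewrite /square_integrable.
suff -> : (\int[mu]_x (sqmod (w x * u (phi x)))%:E =
    \int[mu]_x (sqmod ((k x)%:C * u x))%:E)%E by split=> -[].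
transitivity (\int[mu]_x (sqmod (u (phi x)) * sqmod (w x))%:E)%E.
  by apply: eq_integral => x _; rewrite sqmodM mulrC.
rewrite (integral_w (measurable_sqmod mcu)); apply: eq_integral => x _.
by rewrite sqmodM sqmod_real sqr_sqrt_density mulrC.
Qed.

Lemma op_dom_density u : op_dom C u <-> op_dom P u.
Proof.
rewrite op_dom_weighted_composition// op_dom_multiplication//.
exact: square_integrable_density.
Qed.

(** The real and imaginary parts of u times the conjugate of v have no fixed sign, hence the signed
    change of variables is applied to each. *)
Lemma L2dot_density u v u' v' u2 v2 :
  C (u, u') -> C (v, v') -> P (u, u2) -> P (v, v2) ->
  L2dot mu u' v' = L2dot mu u2 v2.
Proof.
move=> /= Cu Cv Pu Pv.
pose F x := u x * (v x)^*%C.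
have conjM (z t : R[i]) : (z * t)^*%C = z^*%C * t^*%C by exact: rmorphM.
have mconj v0 : cmeasurable (fun x => ((v0 : L2 mu) x)^*%C).
  have [m1 m2] := L2_cmeasurable v0; split.
    by under eq_fun do rewrite Defs.ReJ.
  by under eq_fun do rewrite Defs.ImJ; exact: measurableT_comp.
have mF : cmeasurable F by apply: cmeasurableM => //; exact: L2_cmeasurable.
have [mF1 mF2] := mF.
transitivity (cintegral mu (fun x => F (phi x) * (sqmod (w x))%:C)).
  apply: ae_eq_cintegral.
  - by apply: cmeasurableM => //; exact: L2_cmeasurable.
  - apply: cmeasurableM; first exact: cmeasurable_comp mF.
    by apply: cmeasurable_real; exact: measurable_sqmod.
  - apply: filterS2 Cu Cv => x -> ->; rewrite /F conjM mulrACA mulrC;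
    congr (_ * _).
    by apply: complex_ext; rewrite !(Defs.ReM, Defs.ImM) ?Defs.ReJ ?Defs.ImJ /=
      /sqmod; ring.
transitivity (cintegral mu (fun x => F x * (H x)%:C)); last first.
  apply: ae_eq_cintegral.
  - by apply: cmeasurableM => //; exact: cmeasurable_real.
  - by apply: cmeasurableM => //; exact: L2_cmeasurable.
  - apply: filterS2 Pu Pv => x -> ->; rewrite /F conjM mulrACA mulrC conjc_real.
    by rewrite -sqr_sqrt_density expr2 rmorphM.
have ReMr (z : R[i]) r : complex.Re (z * r%:C) = complex.Re z * r.
  by rewrite Defs.ReM /= mulr0 subr0.
have ImMr (z : R[i]) r : complex.Im (z * r%:C) = complex.Im z * r.
  by rewrite Defs.ImM /= mulr0 add0r.
apply: complex_ext; congr fine.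
  transitivity (\int[mu]_x (complex.Re (F (phi x)) * sqmod (w x))%:E)%E.
    by apply: eq_integral => x _; rewrite ReMr.
  rewrite (integral_w mF1); apply: eq_integral => x _.
  by rewrite ReMr.
transitivity (\int[mu]_x (complex.Im (F (phi x)) * sqmod (w x))%:E)%E.
  by apply: eq_integral => x _; rewrite ImMr.
rewrite (integral_w mF2); apply: eq_integral => x _.
by rewrite ImMr.
Qed.

Lemma op_comp_adjoint_density :
  op_comp P P = op_comp (op_adjoint (L2dot mu) C) C.
Proof.
apply/seteqP; split => -[u v] /= [y uy yv].
  have [z uz] : op_dom C u by apply/op_dom_density; exists y.
  exists z => // -[q q'] /= Cq.
  have [q2 Pq] : op_dom P q by apply/op_dom_density; exists q'.
  (* One factor [P] is read as its adjoint; both memberships then test the same inner products over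
     the common domain. *)
  move: yv; rewrite -[P in P _](multiplication_selfadjoint mu mk).
  move=> /(_ _ Pq) /= <-; exact: L2dot_density Cq uz Pq uy.
have [z uz] : op_dom P u by apply/op_dom_density; exists y.
exists z => //; rewrite -[P](multiplication_selfadjoint mu mk) => -[q q2] /= Pq.
have [q' Cq] : op_dom C q by apply/op_dom_density; exists q2.
have /= <- := yv _ Cq; apply/esym; exact: L2dot_density Cq uy Pq uz.
Qed.

(* The inverse is the junk value 0 where k o phi vanishes, which is almost
   everywhere in the zero set of w. *)
Definition phase_weight x : R[i] := w x * ((k (phi x))^-1)%:C.
Local Notation v0 := phase_weight.

Lemma cmeasurable_phase_weight : cmeasurable v0.
Proof.
apply: cmeasurableM => //; apply: cmeasurable_real.
apply: measurable_inv_ge0 => [|x]; last exact: powR_ge0.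
exact: measurableT_comp mk mphi.
Qed.

(** Shows that the phase preserves the norm of functions supported in {H > 0} and annihilates those
    supported in {H = 0}. *)
Lemma integral_phase_weight u :
  (\int[mu]_x (sqmod (v0 x * u (phi x)))%:E =
   \int[mu]_x (\1_[set y | 0 < H y] x * sqmod (u x))%:E)%E.
Proof.
(* Since the inverse of 0 is 0, the product F H is |u|^2 on {H > 0} and 0 elsewhere. *)
pose F x := (H x)^-1 * sqmod (u x).
have mF : measurable_fun setT F.
  apply: measurable_funM; first exact: measurable_inv_ge0.
  by apply: measurable_sqmod; exact: L2_cmeasurable.
transitivity (\int[mu]_x (F (phi x) * sqmod (w x))%:E)%E.
  apply: eq_integral => x _; rewrite /F !sqmodM sqmod_real exprVn
    sqr_sqrt_density.
  by congr EFin; ring.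
rewrite (integral_w mF); apply: eq_integral => x _; rewrite /F indicE.
congr EFin; have [Hx|Hx] := ltP 0 (H x).
  by rewrite mem_set// mulrAC mulVf ?mul1r// gt_eqF.
rewrite memNset/= ?mul0r; last by apply/negP; rewrite -leNgt.
by rewrite (@le_anti _ _ (H x) 0) ?H0 ?Hx// mulr0.
Qed.

Let integral_positive_le u :
  (\int[mu]_x (\1_[set y | 0 < H y] x * sqmod (u x))%:E <=
   \int[mu]_x (sqmod (u x))%:E)%E.
Proof.
have msu := measurable_sqmod (L2_cmeasurable u).
apply: ge0_le_integral => //.
- by move=> x _; rewrite lee_fin mulr_ge0// sqmod_ge0.
- apply/measurable_EFinP.
  exact: measurable_funM (measurable_indic measurable_positive) msu.
- exact/measurable_EFinP.
- by move=> x _; rewrite lee_fin ler_piMl ?sqmod_ge0.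
Qed.

Lemma linear_phase : exists U : {linear L2 mu -> L2 mu},
  forall u, \forall x \ae mu, (U u : L2 mu) x = v0 x * (u : L2 mu) (phi x).
Proof.
apply: linear_weighted_composition => //; first exact: cmeasurable_phase_weight.
- move=> Q /ae_phi; apply: filterS => x Qx v0x; apply: Qx.
  by apply: contraNneq v0x => w0; rewrite /v0 w0 mul0r.
- move=> u; split.
    apply: cmeasurableM; first exact: cmeasurable_phase_weight.
    by apply: cmeasurable_comp => //; exact: L2_cmeasurable.
  rewrite integral_phase_weight; apply: le_lt_trans (L2_integral_lty u).
  exact: integral_positive_le.
Qed.

Section phase.
Variable U : {linear L2 mu -> L2 mu}.
Hypothesis UE : forall u,
  \forall x \ae mu, (U u : L2 mu) x = v0 x * (u : L2 mu) (phi x).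

Let UU u : L2dot mu (U u) (U u) =
  (fine (\int[mu]_x (\1_[set y | 0 < H y] x * sqmod (u x))%:E)%E)%:C.
Proof.
rewrite L2dotE; congr ((fine _)%:C); rewrite -integral_phase_weight.
apply: ge0_ae_eq_integral => //.
- by apply: emeasurable_sqmod; exact: L2_cmeasurable.
- apply: emeasurable_sqmod; apply: cmeasurableM;
  first exact: cmeasurable_phase_weight.
  by apply: cmeasurable_comp => //; exact: L2_cmeasurable.
- by move=> x _; rewrite lee_fin sqmod_ge0.
- by move=> x _; rewrite lee_fin sqmod_ge0.
- by apply: filterS (UE u) => x ->.
Qed.

Let fin_integral u : ((\int[mu]_x (sqmod (u x))%:E)%E \is a fin_num).
Proof.
rewrite ge0_fin_numE ?L2_integral_lty//.
by apply: integral_ge0 => x _; rewrite lee_fin sqmod_ge0.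
Qed.

(** The part of [u] living on {H = 0} is in the kernel of [U]. If [u] is orthogonal to the kernel,
    it is orthogonal to this part, which is therefore 0, and the norm of [U u] is the full norm of
    [u]. *)
Lemma partial_isometry_phase : partial_isometry (L2dot mu) U.
Proof.
split.
  exists 1 => u; rewrite mul1r -[X in X <= _]/(L2dot mu (U u) (U u)) UU.
  rewrite -[X in _ <= X]/(L2dot mu u u) L2dotE lecR fine_le//.
  rewrite ge0_fin_numE; last first.
    by apply: integral_ge0 => x _; rewrite lee_fin mulr_ge0// sqmod_ge0.
  exact: le_lt_trans (integral_positive_le u) (L2_integral_lty u).
move=> u uker; rewrite -[LHS]/(L2dot mu (U u) (U u)) UU.
rewrite -[RHS]/(L2dot mu u u) L2dotE; congr ((fine _)%:C).
pose A : set X := ~` [set x | 0 < H x]; pose r : X -> R := \1_A.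
have mr : measurable_fun setT r by exact: measurable_indic (measurableC
  measurable_positive).
have r1 x : `|r x| <= 1 by rewrite /r indicE; case: (_ \in _);
  rewrite ?normr1 ?normr0.
pose y := toL2 mu (fun x => (r x)%:C * (u : L2 mu) x).
have yE : \forall x \ae mu, y x = (r x)%:C * (u : L2 mu) x.
  exact: toL2E (square_integrable_mulb u mr r1).
have Uy : U y = 0.
  apply: L2_ext; apply: filterS3 (ae_and (UE y) l2repr0) (ae_phi yE)
    ae_density_gt0.
  move=> x [-> ->]; rewrite /v0.
  have [->|wx /(_ isT) -> /(_ isT) Hx] := eqVneq (w x) 0;
    first by rewrite !mul0r.
  by rewrite /r indicE memNset ?mul0r ?mulr0// /A /=; apply.
have y0 : y = 0.
  apply: L2dot_eq0; rewrite -[RHS](uker y Uy); apply: (L2dot_mulC yE).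
  apply: filterS yE => x ->; rewrite mulrA -rmorphM /= /r indicE.
  by case: (_ \in _); rewrite ?mulr0 ?mulr1.
apply: ge0_ae_eq_integral => //.
- apply/measurable_EFinP; apply: measurable_funM (measurable_indic
  measurable_positive) _.
  exact: measurable_sqmod (L2_cmeasurable u).
- exact: emeasurable_sqmod (L2_cmeasurable u).
- by move=> x _; rewrite lee_fin mulr_ge0// sqmod_ge0.
- by move=> x _; rewrite lee_fin sqmod_ge0.
- apply: filterS2 yE l2repr0 => x; rewrite y0 => -> /eqP + _.
  rewrite mulf_eq0 => /orP[|/eqP ->]; last by rewrite /sqmod /= expr0n /= addr0
    mulr0.
  rewrite /r !indicE /A in_setC; case: (_ \in _) => /=; first by rewrite mul1r.
  by rewrite eq_complex /= oner_eq0.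
Qed.

Let v0K x y : (w x != 0 -> 0 < H (phi x)) ->
  v0 x * ((k (phi x))%:C * y) = w x * y.
Proof.
rewrite /v0; have [->|wx /(_ isT) Hx] := eqVneq (w x) 0;
  first by rewrite !mul0r.
rewrite -mulrA; congr (_ * _); rewrite mulrA -rmorphM /= mulVf ?mul1r//.
by rewrite gt_eqF// sqrt_density_gt0.
Qed.

Let U_sqrt_density u y : P (u, y) -> C (u, U y).
Proof.
move=> /ae_phi uy; rewrite /C /weighted_composition /=.
apply: filterS3 (UE y) uy ae_density_gt0 => x -> yE Hx.
have [w0|/yE /= ->] := eqVneq (w x) 0; last exact: v0K.
by rewrite /v0 w0 !mul0r.
Qed.

Lemma polar_decomposition_weighted_composition :
  polar_decomposition (L2dot mu) C U P.
Proof.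
split.
- by apply: (positive_selfadjoint_multiplication mu mk) => x; exact: powR_ge0.
- exact: op_comp_adjoint_density.
- exact: partial_isometry_phase.
- move=> u; rewrite /C /weighted_composition /=; split=> [Uu0|Cu0].
    apply: filterS3 (UE u) l2repr0 ae_density_gt0 => x E z Hx.
    by rewrite -(v0K _ Hx) mulrCA -E Uu0 z mulr0.
  apply: L2_ext; apply: filterS3 (UE u) l2repr0 Cu0 => x -> z E.
  by rewrite /v0 mulrAC -E z mul0r.
- apply/seteqP; split => -[u v] /= => [uv|[y uy yv]].
    have [y uy] : op_dom P u by apply/op_dom_density; exists v.
    exists y => //; suff -> : v = U y by [].
    by apply: L2_ext; apply: filterS2 uv (U_sqrt_density uy) => x /= -> ->.
  by have -> : v = U y by []; exact: U_sqrt_density.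
Qed.

Variables (a : R) (wa : X -> R[i]).
Hypothesis mwa : cmeasurable wa.
Hypothesis waE : \forall x \ae mu,
  wa x = w x * ((H x / H (phi x)) `^ (a / 2))%:C.

(** The quantifier on [t] is inside the almost everywhere statement because [t] will be u(phi x),
    which varies with [x]. *)
Let waK : \forall x \ae mu, forall t,
  (k x `^ a)%:C * (v0 x * ((k (phi x) `^ (1 - a))%:C * t)) = wa x * t.
Proof.
apply: filterS2 waE ae_density_gt0 => x -> Hx t; rewrite /v0.
have [->|wx] := eqVneq (w x) 0; first by rewrite !mul0r mulr0.
have kx : 0 < k (phi x) by rewrite sqrt_density_gt0; exact: Hx.
have -> : (H x / H (phi x)) `^ (a / 2) =
    k x `^ a * ((k (phi x))^-1 * k (phi x) `^ (1 - a)).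
  by apply: powR_div_half; rewrite ?H0//; exact: Hx.
have realM (p q : R) : (p * q)%:C = p%:C * q%:C by exact: rmorphM.
have mulC (p q r s z : R[i]) : p * (q * r * (s * z)) = q * (p * (r * s)) * z by
  ring.
by rewrite !realM; exact: mulC.
Qed.

(** Only the domain of k^(1 - a) needs the hypothesis; membership in the domain of k^a is automatic,
    because the final product is already a given element of [L2 mu]. *)
Lemma aluthge_weighted_composition :
  (forall u, square_integrable mu (fun x => wa x * u (phi x)) ->
    square_integrable mu (fun x => (k x `^ (1 - a))%:C * u x)) ->
  weighted_composition phi wa = op_comp (multiplication (fun x => k x `^ a))
    (op_comp (op_of_fun U) (multiplication (fun x => k x `^ (1 - a)))).
Proof.
move=> dom; have mk1a : measurable_fun setT (fun x => k x `^ (1 - a)).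
  exact: measurableT_comp (measurable_powR _) mk.
have key (u y v : L2 mu) : multiplication (fun x => k x `^ (1 - a)) (u, y) ->
    \forall x \ae mu, (k x `^ a)%:C * (U y : L2 mu) x = wa x * u (phi x).
  move=> /ae_phi uy; apply: filterS3 (UE y) uy waK => x -> yE <-.
  congr (_ * _); have [w0|/yE /= -> //] := eqVneq (w x) 0.
  by rewrite /v0 w0 !mul0r.
apply/seteqP; split => -[u v] /= => [uv|[z [y uy zy] zv]].
  have [y uy] : op_dom (multiplication (fun x => k x `^ (1 - a))) u.
    apply/op_dom_multiplication => //; apply: dom.
    by apply/op_dom_weighted_composition => //; exists v.
  exists (U y); first by exists y.
  by apply: filterS2 (key _ _ v uy) uv => x /= -> ->.
have zE : z = U y by [].
apply: filterS2 (key _ _ v uy) zv => x /= <-.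
by rewrite zE.
Qed.

End phase.
End polar_decomposition.

(** * Radon-Nikodym derivatives and conditional expectations *)

Section radon_nikodym.
Context (d : measure_display) (X : measurableType d) (R : realType).
Variable mu : {sigma_finite_measure set X -> \bar R}.
Variables (w : X -> R[i]) (phi : X -> X) (h : X -> \bar R).
Hypotheses (mw : cmeasurable w) (mphi : measurable_fun setT phi).
Hypothesis hh : is_RN_derivative mu (pushforward (weighted_measure mu w) phi) h.

Let mh : measurable_fun setT h. Proof. by case: hh. Qed.
Let h0 x : (0 <= h x)%E. Proof. by case: hh. Qed.

Let dens D : measurable D ->
  (\int[mu]_(x in phi @^-1` D) (sqmod (w x))%:E = \int[mu]_(x in D) h x)%E.
Proof. by case: hh => _ _; exact. Qed.

Let integral_w (F : X -> \bar R) : measurable_fun setT F -> (forall x, 0 <= F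
  x)%E ->
  (\int[mu]_x (F (phi x) * (sqmod (w x))%:E) = \int[mu]_x (F x * h x))%E.
Proof.
apply: ge0_integral_density => //; first exact: emeasurable_sqmod.
by move=> x; rewrite lee_fin sqmod_ge0.
Qed.

(** Functions in the domain have |y|^2 h integrable, so they vanish on {h = +oo}. The indicator of a
    finite-measure piece of that set is then at squared distance at least its measure from the
    domain, and density forces this measure to be 0. *)
Lemma RN_derivative_lty :
  densely_defined (L2dot mu) (weighted_composition phi w) ->
  \forall x \ae mu, (h x < +oo)%E.
Proof.
move=> dd; pose D := h @^-1` [set +oo%E].
have mD : measurable D by rewrite /D -[_ @^-1` _]setTI; exact: mh.
have dom0 (y : L2 mu) : op_dom (weighted_composition phi w) y ->
    \forall x \ae mu, D x -> y x = 0.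
  move=> /op_dom_weighted_composition -/(_ mphi mw)[_ yi].
  have my := L2_cmeasurable y.
  have : mu.-integrable setT (fun x => (sqmod (y x))%:E * h x)%E.
    apply/integrableP; split; first exact: emeasurable_funM (emeasurable_sqmod
      my) mh.
    under eq_integral do rewrite gee0_abs ?mule_ge0 ?lee_fin ?sqmod_ge0//.
    rewrite -(integral_w (emeasurable_sqmod my)); last first.
      by move=> x; rewrite lee_fin sqmod_ge0.
    apply: le_lt_trans yi; rewrite le_eqVlt; apply/orP; left; apply/eqP.
    by apply: eq_integral => x _; rewrite sqmodM mulrC EFinM.
  move=> /(integrable_ae measurableT); apply: filterS => x /(_ I) + Dx.
  rewrite Dx; have [y0 _|y0] := eqVneq (sqmod (y x)) 0.
    by apply/eqP; rewrite -sqmod_eq0 y0.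
  by rewrite gt0_muley// lte_fin lt_def y0 sqmod_ge0.
have [F FT Ffin] := sigma_finiteT mu.
suff DF n : mu (D `&` F n) = 0%E.
  have DFn : mu.-negligible (\bigcup_n (D `&` F n)).
    apply: negligible_bigcup => n; have [mF _] := Ffin n.
    by apply/negligibleP; [exact: measurableI|exact: DF].
  apply: negligibleS DFn => x /= /negP; rewrite -leNgt leye_eq => /eqP hx.
  have [n _ Fx] : (\bigcup_i F i) x by rewrite -FT.
  by exists n.
have [mF Foo] := Ffin n; have mDF := measurableI _ _ mD mF.
have DFoo : (mu (D `&` F n) < +oo)%E.
  by apply: le_lt_trans Foo; apply: le_measure; rewrite ?inE//; exact: subIsetr.
have xi : square_integrable mu (fun x => (\1_(D `&` F n) x)%:C).
  split; first by apply: cmeasurable_real; exact: measurable_indic.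
  under eq_integral do rewrite sqmod_real indicE expr2 -natrM mulnb andbb
    -indicE.
  by rewrite integral_indic// setIT.
have xE := toL2E xi; pose x : L2 mu := toL2 mu (fun x => (\1_(D `&` F n) x)%:C).
apply/eqP; rewrite eq_le measure_ge0 andbT; apply/lee_addgt0Pr => e e0.
rewrite add0e.
(* [densely_defined] bounds the squared norm by the square of its parameter, so this choice yields
   [e]. *)
have se0 : 0 < Num.sqrt e by rewrite sqrtr_gt0.
have [y /dom0 y0 xy] := dd x _ se0.
have {}xy : \int[mu]_t sqmod ((x - y : L2 mu) t) < e.
  by rewrite -ltcR -L2dotE -[e]sqr_sqrtr ?ltW.
have xyi : (\int[mu]_t (sqmod ((x - y : L2 mu) t))%:E)%E \is a fin_num.
  rewrite ge0_fin_numE ?L2_integral_lty//.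
  by apply: integral_ge0 => t _; rewrite lee_fin sqmod_ge0.
move: xy; rewrite -lte_fin fineK// => /ltW; apply: le_trans.
rewrite -[D `&` F n]setIT -integral_indic//; apply: ae_ge0_le_integral => //.
- by apply/measurable_EFinP; exact: measurable_indic.
- by move=> t _; rewrite lee_fin sqmod_ge0.
- exact: emeasurable_sqmod (L2_cmeasurable _).
- apply: filterS3 (l2reprB x y) xE y0 => t -> xt yt _; rewrite lee_fin.
  rewrite -/x xt indicE; case: (boolP (t \in _)) => [/set_mem[Dt _]|_] /=.
    by rewrite yt// subr0 sqmod_real expr1n.
  exact: sqmod_ge0.
Qed.

End radon_nikodym.

Section conditional_expectation.
Context (d : measure_display) (X : measurableType d) (R : realType).
Variable mu : {sigma_finite_measure set X -> \bar R}.
Variables (w : X -> R[i]) (phi : X -> X) (a : R) (h Eh g : X -> \bar R).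
Hypotheses (mw : cmeasurable w) (mphi : measurable_fun setT phi).
Hypothesis hh : is_RN_derivative mu (pushforward (weighted_measure mu w) phi) h.
Hypothesis hEh : is_conditional_expectation mu phi w (fun x => h x `^ a)%E Eh.
Hypothesis hg : is_condexp_pullback mu phi w h Eh g.
Hypothesis a01 : 0 < a <= 1.
Local Open Scope ereal_scope.

Let mh : measurable_fun setT h. Proof. by case: hh. Qed.
Let h0 x : 0 <= h x. Proof. by case: hh. Qed.
Let mg : measurable_fun setT g. Proof. by case: hg. Qed.
Let g0 x : 0 <= g x. Proof. by case: hg. Qed.
Let mha : measurable_fun setT (fun x => h x `^ a).
Proof. exact: measurableT_comp (measurable_poweR a) mh. Qed.
Let ha0 x : 0 <= h x `^ a. Proof. exact: poweR_ge0. Qed.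
Let w0 x : 0 <= (sqmod (w x))%:E. Proof. by rewrite lee_fin sqmod_ge0. Qed.
Let msw := emeasurable_sqmod mw.

Let dens D : measurable D ->
  \int[mu]_(x in phi @^-1` D) (sqmod (w x))%:E = \int[mu]_(x in D) h x.
Proof. by case: hh => _ _; exact. Qed.

(** Over phi^-1(D), conditioning replaces h^a by g o phi, and the change of variables turns |w|^2
    into h. *)
Let condexp_density D : measurable D ->
  \int[mu]_(x in phi @^-1` D) (h x `^ a * (sqmod (w x))%:E) =
  \int[mu]_(x in D) (g x * h x).
Proof.
move=> mD; have mphiD : measurable (phi @^-1` D).
  by rewrite -[_ @^-1` _]setTI; exact: mphi.
have [mEh Eh0 Ehint] := hEh.
have mEh' : measurable_fun setT Eh.
  move=> _ B mB; rewrite setTI; have [D' mD' <-] := mEh B mB.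
  exact: mphi.
rewrite -integral_weighted_measure// -Ehint// integral_weighted_measure//.
have mgD : measurable_fun setT (g \_ D).
  by apply/(measurable_restrictT _ mD).1; exact: measurable_funTS.
have gD0 x : 0 <= (g \_ D) x by rewrite patchE; case: ifP.
transitivity (\int[mu]_x ((g \_ D) (phi x) * (sqmod (w x))%:E)).
  rewrite integral_mkcond; apply: ge0_ae_eq_integral => //.
  - apply/(measurable_restrictT _ mphiD).1/measurable_funTS.
    exact: emeasurable_funM mEh' msw.
  - exact: emeasurable_funM (measurableT_comp mgD mphi) msw.
  - by move=> x _; rewrite patchE; case: ifP => // _; rewrite mule_ge0.
  - by move=> x _; rewrite mule_ge0.
  - have [_ _ /(ae_weighted_measure mw) Ehg _] := hg.
    apply: filterS Ehg => x Ehg _; rewrite !patchE.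
    rewrite (_ : (x \in phi @^-1` D) = (phi x \in D))//.
    case: ifP => _; last by rewrite mul0e.
    have [wx|/Ehg -> //] := eqVneq (w x) 0%R.
    by rewrite wx sqmod_real expr0n !mule0.
rewrite (ge0_integral_density mphi msw w0 mh h0 dens)//.
rewrite [RHS]integral_mkcond; apply: eq_integral => x _.
by rewrite !patchE; case: ifP => // _; rewrite mul0e.
Qed.

Lemma ge0_integral_condexp (F : X -> \bar R) :
  measurable_fun setT F -> (forall x, 0 <= F x) ->
  \int[mu]_x (F (phi x) * (h x `^ a * (sqmod (w x))%:E)) =
  \int[mu]_x (F x * (g x * h x)).
Proof.
apply: ge0_integral_density => //.
- exact: emeasurable_funM.
- by move=> x; rewrite mule_ge0.
- exact: emeasurable_funM.
- by move=> x; rewrite mule_ge0.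
Qed.

Hypothesis hfin : \forall x \ae mu, h x < +oo.

(** For D inside {g < b}, with b = c^a, the integral over D of b h is that of b |w|^2 over
    phi^-1(D), hence at most that of h^a |w|^2, which is the integral of g h over D. As (b - g) h >=
    0 on D, it vanishes there, which forces h = 0. *)
Lemma condexp_pullback_ge (c : R) : (0 < c)%R -> (\forall x \ae mu, c%:E <= h
  x) ->
  \forall x \ae mu, h x != 0 -> (c `^ a)%:E <= g x.
Proof.
move=> c0 ch; pose b := (c `^ a)%R; have b0 : (0 < b)%R by exact: powR_gt0.
have bE0 : 0 <= b%:E by rewrite lee_fin ltW.
have [F FT Ffin] := sigma_finiteT mu.
suff {}Fn n m : \forall x \ae mu, g x < b%:E -> h x <= n%:R%:E -> F m x -> h x
  = 0.
  have : \forall x \ae mu, forall n m, g x < b%:E -> h x <= n%:R%:E -> F m x ->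
    h x = 0.
    by apply: ae_foralln => n; exact: ae_foralln.
  apply: filterS2 hfin => x hx Fx; apply: contraNT; rewrite -ltNge => gx.
  have [m _ Fmx] : (\bigcup_i F i) x by rewrite -FT.
  apply/eqP/(Fx (Num.truncn (fine (h x))).+1 m gx _ Fmx).
  have hxfin : h x \is a fin_num by rewrite ge0_fin_numE.
  by rewrite -(fineK hxfin) lee_fin ltW// truncnS_gt.
have [mF Foo] := Ffin m.
(* Bounding h and cutting to a set of finite measure makes the integral of b h finite, so that it
   can be subtracted; the pieces exhaust {g < b} almost everywhere. *)
pose D := [set x | g x < b%:E] `&` ([set x | h x <= n%:R%:E] `&` F m).
have mD : measurable D.
  apply: measurableI; last apply: measurableI => //.
  - rewrite -[X in measurable X]setTI; exact: emeasurable_fun_infty_o.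
  - rewrite -[X in measurable X]setTI; exact: emeasurable_fun_infty_c.
have mphiD : measurable (phi @^-1` D) by rewrite -[_ @^-1` _]setTI; exact: mphi.
pose u x := (b%:E - g x) * h x.
have mmu : measurable_fun setT u.
  by apply: emeasurable_funM => //; exact: emeasurable_funB.
have u0 x : D x -> 0 <= u x.
  by move=> [gx _]; rewrite mule_ge0// sube_ge0 ?ltW// orbT.
have le_gh : \int[mu]_(x in D) (b%:E * h x) <= \int[mu]_(x in D) (g x * h x).
  rewrite -condexp_density// ge0_integralZl//; last exact: measurable_funTS.
  rewrite -dens// -ge0_integralZl//; last exact: measurable_funTS.
  apply: ae_ge0_le_integral => //.
  - by move=> x _; rewrite mule_ge0.
  - by apply: measurable_funTS; exact: measurable_funeM.
  - by move=> x _; rewrite mule_ge0.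
  - by apply: measurable_funTS; exact: emeasurable_funM.
  - apply: filterS2 ch hfin => x ch hx _; rewrite lee_wpmul2r// /b.
    have hxfin : h x \is a fin_num by rewrite ge0_fin_numE.
    move: ch; rewrite -(fineK hxfin) poweR_EFin !lee_fin => ch.
    rewrite ge0_ler_powR ?nnegrE ?fine_ge0 ?(ltW c0)//.
    by case/andP: a01 => /ltW.
have bh_u : \int[mu]_(x in D) (b%:E * h x) =
    \int[mu]_(x in D) u x + \int[mu]_(x in D) (g x * h x).
  rewrite -ge0_integralD//; first last.
  - by apply: measurable_funTS; exact: emeasurable_funM.
  - by move=> x _; rewrite mule_ge0.
  - exact: measurable_funTS.
  apply: eq_integral => x /set_mem Dx; have [gx _] := Dx.
  have gfin : g x \is a fin_num.
    by rewrite ge0_fin_numE// (lt_trans gx)// ltry.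
  by rewrite /u -ge0_muleDl ?subeK// sube_ge0 ?ltW// orbT.
have bh_oo : \int[mu]_(x in D) (b%:E * h x) < +oo.
  apply: (@le_lt_trans _ _ (\int[mu]_(x in D) (cst (b * n%:R)%:E) x)).
    apply: ge0_le_integral => //.
    - by move=> x _; rewrite mule_ge0.
    - by apply: measurable_funTS; exact: measurable_funeM.
    - by move=> x [_ [hx _]]; rewrite EFinM lee_wpmul2l.
  rewrite integral_cst//; apply: lte_mul_pinfty => //.
    by rewrite lee_fin mulr_ge0// ltW.
  apply: le_lt_trans Foo; apply: le_measure; rewrite ?inE//.
  by apply: subIset; right; exact: subIsetr.
have int_u0 : \int[mu]_(x in D) u x = 0.
  have gh_fin : \int[mu]_(x in D) (g x * h x) \is a fin_num.
    rewrite ge0_fin_numE; last by apply: integral_ge0 => x _; rewrite mule_ge0.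
    apply: le_lt_trans bh_oo; rewrite bh_u leeDr//; exact: integral_ge0.
  apply/eqP; rewrite eq_le integral_ge0// andbT.
  by rewrite -(leeD2rE _ _ gh_fin) add0e -bh_u.
have /(ae_eq_integral_abs mu mD (measurable_funTS mmu)) :
    \int[mu]_(x in D) `|u x| = 0.
  by rewrite -[RHS]int_u0; apply: eq_integral => x /set_mem Dx;
    rewrite gee0_abs ?u0.
apply: filterS => x Dx0 gx hx Fx; have /eqP := Dx0 (conj gx (conj hx Fx)).
rewrite /u mule_eq0 => /orP[|/eqP//].
by rewrite gt_eqF// sube_gt0.
Qed.

End conditional_expectation.

(** * The transformed weight and the comparison of domains *)

Section transformed_weight.
Context (d : measure_display) (X : measurableType d) (R : realType).
Variable mu : {sigma_finite_measure set X -> \bar R}.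
Variables (w : X -> R[i]) (phi : X -> X) (a : R) (h Eh g : X -> \bar R).
Variable wa : X -> R[i].
Hypotheses (mw : cmeasurable w) (mphi : measurable_fun setT phi).
Hypothesis hh : is_RN_derivative mu (pushforward (weighted_measure mu w) phi) h.
Hypothesis hEh : is_conditional_expectation mu phi w (fun x => h x `^ a)%E Eh.
Hypothesis hg : is_condexp_pullback mu phi w h Eh g.
Hypothesis hwa : is_transformed_weight mu phi w h a wa.
Hypothesis hfin : \forall x \ae mu, (h x < +oo)%E.

Let H x := fine (h x).

Let mh : measurable_fun setT h. Proof. by case: hh. Qed.
Let h0 x : (0 <= h x)%E. Proof. by case: hh. Qed.
Let mg : measurable_fun setT g. Proof. by case: hg. Qed.
Let g0 x : (0 <= g x)%E. Proof. by case: hg. Qed.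
Let mH : measurable_fun setT H.
Proof. exact: measurableT_comp. Qed.
Let H0 x : 0 <= H x. Proof. exact: fine_ge0. Qed.

Let hE : \forall x \ae mu, h x = (H x)%:E.
Proof. by apply: filterS hfin => x hx; rewrite fineK// ge0_fin_numE. Qed.

Lemma fine_RN_derivative D : measurable D ->
  (\int[mu]_(x in phi @^-1` D) (sqmod (w x))%:E = \int[mu]_(x in D) (H x)%:E)%E.
Proof.
move=> mD; have [_ _ /(_ _ mD) hD] := hh.
rewrite [LHS]hD; apply: ge0_ae_eq_integral => //.
- exact: measurable_funTS.
- exact/measurable_EFinP/measurable_funTS.
- by move=> x _; rewrite lee_fin.
- by apply: filterS hE => x -> _.
Qed.

(** F o phi is what remains of |w_a (u o phi)|^2 once h^a |w|^2 is factored out. The conventions for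
    0 agree: the inverse of 0, raised to [a], is 0 raised to [- a]. *)
Let F (u : L2 mu) x := (H x `^ (- a) * sqmod (u x))%:E.

Let mF u : measurable_fun setT (F u).
Proof.
apply/measurable_EFinP; apply: measurable_funM.
  exact: measurableT_comp (measurable_powR _) mH.
exact: measurable_sqmod (L2_cmeasurable u).
Qed.

Let F0 u x : (0 <= F u x)%E.
Proof. by rewrite lee_fin mulr_ge0 ?powR_ge0 ?sqmod_ge0. Qed.

Let integral_transformed_weight (u : L2 mu) :
  (\int[mu]_x (sqmod (wa x * u (phi x)))%:E = \int[mu]_x (F u x * (g x * h
    x)))%E.
Proof.
rewrite -(ge0_integral_condexp mw mphi hh hEh hg)//; have [mwa waE] := hwa.
have msw := emeasurable_sqmod mw.
apply: ge0_ae_eq_integral => //.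
- apply: emeasurable_sqmod; apply: cmeasurableM => //.
  by apply: cmeasurable_comp => //; exact: L2_cmeasurable.
- apply: emeasurable_funM; first exact: measurableT_comp (mF u) mphi.
  by apply: emeasurable_funM => //; exact: measurableT_comp (measurable_poweR
    a) mh.
- by move=> x _; rewrite lee_fin sqmod_ge0.
- by move=> x _; rewrite !mule_ge0 ?poweR_ge0// lee_fin sqmod_ge0.
have inv_powR (y : R) : 0 <= y -> y^-1 `^ a = y `^ (- a).
  by move=> y0; rewrite -powR_inv1// -powRrM mulN1r.
have sqr_powR (y : R) : (y `^ (a / 2)) ^+ 2 = y `^ a.
  by rewrite -powR_mulrn ?powR_ge0// -powRrM mulfVK// pnatr_eq0.
apply: filterS2 waE hE => x -> hx _.
rewrite -/(H x) -/(H (phi x)) !sqmodM sqmod_real sqr_powR.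
rewrite powRM ?invr_ge0// inv_powR//.
rewrite hx poweR_EFin /F -!EFinM; congr EFin.
by ring.
Qed.

(** The integrand h^(1 - a) |u|^2 is at most (c + 1) |u|^2 + c g h^(1 - a) |u|^2, and both terms
    have finite integral. *)
Lemma square_integrable_transformed_weight (c : R) : 0 <= c ->
  (\forall x \ae mu, h x != 0 ->
    h x `^ (1 - a) <= c%:E * (1 + g x * h x `^ (1 - a)))%E ->
  forall u : L2 mu, square_integrable mu (fun x => wa x * u (phi x)) ->
  square_integrable mu (fun x => (sqrt_density H x `^ (1 - a))%:C * u x).
Proof.
move=> c0 hc u [_]; rewrite integral_transformed_weight => Fi.
have mcu := L2_cmeasurable u; have msu := emeasurable_sqmod mcu.
have mk1a : measurable_fun setT (fun x => sqrt_density H x `^ (1 - a)).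
  exact: measurableT_comp (measurable_powR _) (measurable_sqrt_density mH).
split; first by apply: cmeasurableM => //; exact: cmeasurable_real.
have mku : measurable_fun setT (fun x => (sqmod ((sqrt_density H x `^ (1 -
  a))%:C * u x))%:E).
  exact: emeasurable_sqmod (cmeasurableM (cmeasurable_real mk1a) mcu).
have mFgh : measurable_fun setT (fun x => F u x * (g x * h x))%E.
  apply: emeasurable_funM => //; exact: emeasurable_funM.
have csu0 x : (0 <= (c + 1)%:E * (sqmod (u x))%:E)%E.
  by apply: mule_ge0; rewrite lee_fin ?sqmod_ge0// addr_ge0.
have cFgh0 x : (0 <= c%:E * (F u x * (g x * h x)))%E by rewrite !mule_ge0.
apply: (@le_lt_trans _ _ (\int[mu]_x ((c + 1)%:E * (sqmod (u x))%:E +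
    c%:E * (F u x * (g x * h x))))%E).
  apply: ae_ge0_le_integral => //.
  - by move=> x _; rewrite lee_fin sqmod_ge0.
  - by move=> x _; exact: adde_ge0.
  - exact: emeasurable_funD (measurable_funeM _ msu) (measurable_funeM _ mFgh).
  - apply: filterS2 hc hE => x hc hx _.
    have -> : sqmod ((sqrt_density H x `^ (1 - a))%:C * u x) =
        H x `^ (1 - a) * sqmod (u x).
      rewrite sqmodM sqmod_real -powR_mulrn ?powR_ge0// /sqrt_density -!powRrM.
      by congr (_ `^ _ * _); field.
    set s := sqmod (u x); have s0 : 0 <= s by exact: sqmod_ge0.
    (* Condition (iv) says nothing on {h = 0}. There 0 raised to 1 - a is 0, or 1 when a = 1; this
       is why the constant is c + 1 rather than c. *)
    have [hx0|hx0] := eqVneq (h x) 0%E.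
      apply: le_trans (leeDl _ _); last by rewrite !mule_ge0.
      move: hx; rewrite hx0 -EFinM lee_fin => -[<-]; rewrite ler_wpM2r//.
      apply: (@le_trans _ _ 1); last by rewrite lerDr.
      have [->|a1] := eqVneq (1 - a) 0; first by rewrite powRr0.
      by rewrite powR0.
    have Hx0 : H x != 0 by apply: contraNneq hx0 => Hx0; rewrite hx Hx0.
    have HE : H x `^ (1 - a) = H x `^ (- a) * H x.
      by rewrite addrC powRD ?Hx0 ?implybT// powRr1.
    move: (hc hx0); rewrite hx poweR_EFin => {}hc.
    have FE : (F u x * (g x * (H x)%:E) = g x * (H x `^ (1 - a))%:E * s%:E)%E.
      by rewrite muleCA -muleA -!EFinM HE /F -/s; congr (_ * _%:E)%E; ring.
    rewrite FE EFinM; apply: (le_trans (lee_wpmul2r _ hc));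
      first by rewrite lee_fin.
    rewrite -muleA ge0_muleDl//; last by rewrite mule_ge0// lee_fin powR_ge0.
    rewrite mul1e ge0_muleDr ?lee_fin//; last by rewrite !mule_ge0// lee_fin
      ?powR_ge0.
    by rewrite leeD2r// lee_wpmul2r ?lee_fin// lerDl.
rewrite ge0_integralD//; last 2 first.
- exact: measurable_funeM.
- exact: measurable_funeM.
rewrite !ge0_integralZl//; first last.
- by rewrite lee_fin addr_ge0.
- by move=> x _; rewrite lee_fin sqmod_ge0.
- by move=> x _; rewrite !mule_ge0.
by rewrite lte_add_pinfty// lte_mul_pinfty ?lee_fin ?addr_ge0// L2_integral_lty.
Qed.

End transformed_weight.

(** * Comparison of the four conditions and the Aluthge transform *)

Theorem proposition6 (d : measure_display) (X : measurableType d) (R : realType)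
    (mu : {sigma_finite_measure set X -> \bar R})
    (w : X -> R[i]) (phi : X -> X) (a : R)
    (h Eh g : X -> \bar R) (wa : X -> R[i])
    (mw : cmeasurable w) (mphi : measurable_fun setT phi)
    (w_mu : pushforward (weighted_measure mu w) phi `<< mu)
    (a01 : 0 < a <= 1)
    (hh : is_RN_derivative mu (pushforward (weighted_measure mu w) phi) h)
    (ddC : densely_defined (L2dot mu) (weighted_composition phi w))
    (hEh : is_conditional_expectation mu phi w (fun x => h x `^ a)%E Eh)
    (hg : is_condexp_pullback mu phi w h Eh g)
    (hwa : is_transformed_weight mu phi w h a wa) :
  let ci := exists2 c : R, 0 < c & \forall x \ae mu, (c%:E <= h x)%E in
  let cii := exists2 c : R, 0 < c &
    \forall x \ae mu, (h x != 0 -> c%:E <= g x)%E in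
  let ciii := exists2 c : R, 0 < c &
    \forall x \ae mu,
      (h x != 0 -> h x `^ (1 - a) <= c%:E * (g x * h x `^ (1 - a)))%E in
  let civ := exists2 c : R, 0 < c &
    \forall x \ae mu,
      (h x != 0 -> h x `^ (1 - a) <= c%:E * (1 + g x * h x `^ (1 - a)))%E in
  [/\ ci -> cii,
      cii <-> ciii,
      ciii -> civ,
      ('N[mu]_+oo[h] < +oo)%E -> civ
    & ci \/ cii \/ ciii \/ civ ->
      is_aluthge_transform (L2dot mu) a
        (weighted_composition phi w) (weighted_composition phi wa)].
Proof.
have /andP[a0 a1] := a01; have [mh h0 _] := hh; have [mg g0 _ _] := hg.
have hfin := RN_derivative_lty mw mphi hh ddC.
(* A finite positive factor can be cancelled, which is the whole difference between (ii) and
   (iii). *)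
have pow_gt0 : \forall x \ae mu, h x != 0%E ->
    exists2 p : R, 0 < p & (h x `^ (1 - a))%E = p%:E.
  apply: filterS hfin => x hx hx0; exists (fine (h x) `^ (1 - a)).
    by rewrite powR_gt0// fine_gt0// lt_def hx0 h0.
  by rewrite -poweR_EFin fineK// ge0_fin_numE.
move=> ci cii ciii civ.
have i_ii : ci -> cii.
  move=> [c c0 hc]; exists (c `^ a); first exact: powR_gt0.
  exact: (condexp_pullback_ge mw mphi hh hEh hg).
have ii_iii : cii -> ciii.
  move=> [c c0 hc]; exists c^-1; first by rewrite invr_gt0.
  apply: filterS2 hc pow_gt0 => x hc pow hx0.
  have [p p0 ->] := pow hx0.
  rewrite muleA -[leLHS]mul1e lee_wpmul2r//; first by rewrite lee_fin ltW.
  have -> : 1%E = ((c^-1)%:E * c%:E)%E by rewrite -EFinM mulVf ?gt_eqF.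
  by rewrite lee_wpmul2l ?hc// lee_fin invr_ge0 ltW.
have iii_ii : ciii -> cii.
  move=> [c c0 hc]; exists c^-1; first by rewrite invr_gt0.
  apply: filterS2 hc pow_gt0 => x hc pow hx0.
  have [p p0 pE] := pow hx0; move: (hc hx0) (g0 x); rewrite pE.
  case: (g x) => [r|_ _|_]; [|by rewrite leey|by rewrite leeNy_eq].
  rewrite -!EFinM !lee_fin mulrA ler_pMl// => cr _.
  by rewrite -[c^-1]mulr1 ler_pdivrMl.
have iii_iv : ciii -> civ.
  move=> [c c0 hc]; exists c => //; apply: filterS hc => x hc hx0.
  apply: le_trans (hc hx0) _; rewrite lee_wpmul2l ?leeDr//.
  by rewrite lee_fin ltW.
split=> //.
  (* The norm is an essential supremum only if mu(X) > 0; otherwise the whole space is a null set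
     and any constant works. *)
  rewrite unlock; case: ifPn => [_ Moo|mu0 _]; last first.
    exists 1 => //; exists setT; split => //; apply/eqP.
    by rewrite eq_le measure_ge0 andbT leNgt.
  pose S := ess_sup mu (abse \o h); pose M := Num.max 0 (fine S).
  (* The first term bounds h^(1 - a), and adding 1 keeps the constant positive even if M = 0. *)
  exists (M `^ (1 - a) + 1); first by rewrite ltr_wpDl ?powR_ge0.
  apply: filterS2 hfin (ess_sup_ge mu (abse \o h)) => x hx hM hx0.
  have hxfin : h x \is a fin_num by rewrite ge0_fin_numE.
  have hxS : (h x <= S)%E by rewrite -[h x]gee0_abs.
  have Sfin : S \is a fin_num by rewrite ge0_fin_numE// (le_trans _ hxS).
  have hxM : fine (h x) <= M by rewrite le_max fine_le ?orbT.
  apply: (@le_trans _ _ (M `^ (1 - a) + 1)%:E).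
    rewrite -(fineK hxfin) poweR_EFin lee_fin ler_wpDr// ge0_ler_powR
      ?subr_ge0//.
      by rewrite nnegrE fine_ge0.
    by rewrite nnegrE le_max lexx.
  rewrite -[leLHS]mule1 lee_wpmul2l ?leeDl ?mule_ge0 ?poweR_ge0//.
  by rewrite lee_fin addr_ge0 ?powR_ge0.
(* Each of the four conditions leads to (iv), which supplies the domain inclusion used at the
   end. *)
move=> cc; have [c c0 hc] : civ.
  by move: cc => [/i_ii/ii_iii/iii_iv|[/ii_iii/iii_iv|[/iii_iv|]]].
pose H x := fine (h x).
have mH : measurable_fun setT H by exact: measurableT_comp.
have H0 x : 0 <= H x by exact: fine_ge0.
have wH := fine_RN_derivative hh hfin.
have [U UE] := linear_phase mw mphi mH H0 wH.
have mk := measurable_sqrt_density mH.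
have [mwa waE] := hwa.
exists U, (multiplication (sqrt_density H)),
  (multiplication (fun x => sqrt_density H x `^ a)),
  (multiplication (fun x => sqrt_density H x `^ (1 - a))); split.
- exact: polar_decomposition_weighted_composition.
- exact: multiplication_power.
- exact: multiplication_power.
- apply: (aluthge_weighted_composition mw mphi mH H0 wH UE mwa waE).
  exact: (square_integrable_transformed_weight mw mphi hh hEh hg hwa hfin (ltW
    c0)).
Qed.
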